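(* Let $\beta_1\ne\beta_2$ and suppose that the perturbed (Heun type) equation is in a double resonance. Then the unfolded Stokes matrices $St_{LL}(\varepsilon),St_{RR}(\varepsilon)$ at infinity satisfy $$St_{LL}(\varepsilon)=e^{2\pi i T_{LL}},\qquad St_{RR}(\varepsilon)=e^{2\pi i T_{RR}}.$$
   Context: Perturbed equation: $L_{2,\varepsilon}(L_{1,\varepsilon}y)=0$, $0<\varepsilon<1$, $\sqrt\varepsilon>0$, whose first-order factors annihilate respectively $\Phi_1(x,\varepsilon)=\left(\frac{x-\sqrt\varepsilon}{x+\sqrt\varepsilon}\right)^{\frac{\beta_1}{2\sqrt\varepsilon}}\left(\frac{1/\sqrt\varepsilon+x}{1/\sqrt\varepsilon-x}\right)^{\frac{\gamma_1}{2\sqrt\varepsilon}}$, $\Phi_2(x,\varepsilon)=\frac{(x-\sqrt\varepsilon)^{\frac{\beta_2}{2\sqrt\varepsilon}-1}}{(x+\sqrt\varepsilon)^{\frac{\beta_2}{2\sqrt\varepsilon}+1}}\left(\frac{1/\sqrt\varepsilon+x}{1/\sqrt\varepsilon-x}\right)^{\frac{\gamma_2}{2\sqrt\varepsilon}}$. Here $\beta_j,\gamma_j\in\mathbb{C}$. Singular points: $x_R=\sqrt\varepsilon$, $x_L=-\sqrt\varepsilon$, $x_{RR}=1/\sqrt\varepsilon$, $x_{LL}=-1/\sqrt\varepsilon$. Double resonance: $\frac{\beta_2-\beta_1}{2\sqrt\varepsilon}$ and $\frac{\gamma_2-\gamma_1}{2\sqrt\varepsilon}$ are both integers, so $\Phi_2/\Phi_1$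 is a rational function. $T_{jj}=\begin{pmatrix}0&d_{jj}\\0&0\end{pmatrix}$ with $d_{jj}=\mathrm{Res}(\Phi_2/\Phi_1;x=x_{jj})$, $j=L,R$. Fundamental matrix at infinity: $\Phi_\infty(x,\varepsilon)=\begin{pmatrix}\Phi_1&\Phi_{12}\\0&\Phi_2\end{pmatrix}$ with $\Phi_{12}(x,\varepsilon)=\Phi_1(x,\varepsilon)\int_{x_*}^x\frac{\Phi_2(z,\varepsilon)}{\Phi_1(z,\varepsilon)}dz$, where $x_*=x_{RR}$ if $\gamma_1-\gamma_2\ge0$ and $x_*=x_{LL}$ if $\gamma_2-\gamma_1>0$ (the integral converges at $x_*$). Unfolded Stokes matrices. Fix $\varrho$ with $\sqrt\varepsilon<\varrho<1/\sqrt\varepsilon$. Let $\Omega_{1,\infty}(\varepsilon)$, $\Omega_{2,\infty}(\varepsilon)$ be two sectorial domains covering $\{|x|>\varrho\}$ cut along the part of the real line joining $x_{RR}$ to $x_{LL}$ through $\infty$: each is a half-plane sector $\{|x|>\varrho\}$ slightly enlarged across the real intervals $(\varrho,x_{RR})$ and $(x_{LL},-\varrho)$; if $\gamma_2-\gamma_1\le0$, $\Omega_{1,\infty}(\varepsilon)$ is the upper and $\Omega_{2,\infty}(\varepsilon)$ the lower one, and if $\gamma_2-\gamma_1>0$, $\Omega_{1,\infty}(\varepsilon)$ is the lower and $\Omega_{2,\infty}(\varepsilon)$ the upper one. Away from the cut they intersect in two components $\Omega_{RR}(\varepsilon)$ (around real $x\in(\varrho,x_{RR})$) and $\Omega_{LL}(\varepsilon)$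 (around real $x\in(x_{LL},-\varrho)$). Let $\Psi_k^\infty(x,\varepsilon)$, $k=1,2$, be the branch of $\Phi_\infty(x,\varepsilon)$ on $\Omega_{k,\infty}(\varepsilon)$ in which the integral is taken from $x_*$ to $x$ along a path inside $\Omega_{k,\infty}(\varepsilon)$, and in which the branches of $\Phi_1,\Phi_2$ on the two domains are chosen to coincide on the component adjacent to $x_*$ (they then also coincide on the other component). The unfolded Stokes matrix $St_{jj}(\varepsilon)$, $j=L,R$, is defined on $\Omega_{jj}(\varepsilon)$ by $St_{jj}(\varepsilon)=(\Psi_1^\infty(x,\varepsilon))^{-1}\Psi_2^\infty(x,\varepsilon)$. *)

(* Defs.v *)
From Stdlib Require Import Reals Factorial.
From Coquelicot Require Import Coquelicot.
Local Open Scope C_scope.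

(** * Complex exponential and logarithm *)

Definition Cexp (z : C) : C :=
  (exp (Re z) * cos (Im z), exp (Re z) * sin (Im z))%R.

(* Argument in (-PI, PI]; the value at 0 is irrelevant. *)
Definition Arg (z : C) : R :=
  if Rle_dec 0 (Im z) then acos (Re z / Cmod z) else (- acos (Re z / Cmod z))%R.

Definition Clog (z : C) : C := (ln (Cmod z), Arg z).

(* The power a^c computed with the determination [l] of log a. *)
Definition cpower (l c : C) : C := Cexp (c * l).

(** * Singular points and the multivalued solutions *)

Inductive sing := xL | xR | xLL | xRR.

Definition sing_point (eps : R) (p : sing) : C :=
  match p with
  | xL => RtoC (- sqrt eps)
  | xR => RtoC (sqrt eps)
  | xLL => RtoC (- / sqrt eps)
  | xRR => RtoC (/ sqrt eps)
  end.

(* The four linear factors x + sqrt eps, x - sqrt eps, 1/sqrt eps + x and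
   1/sqrt eps - x (mind the sign of the last one). *)
Definition sing_factor (eps : R) (p : sing) (x : C) : C :=
  match p with
  | xRR => sing_point eps xRR - x
  | _ => x - sing_point eps p
  end.

(* A choice of logarithms of the four factors at one point. *)
Definition logs := sing -> C.

Definition principal_logs (eps : R) (x : C) : logs :=
  fun p => Clog (sing_factor eps p x).

(* [Phi1] and [Phi2] are multivalued in x, so they are written as functions of
   the chosen logarithms of the four factors; the same choice serves both, so
   that in double resonance [Phi2 / Phi1] does not depend on it. *)
Definition Phi1 (eps : R) (b1 g1 : C) (l : logs) : C :=
  cpower (l xR - l xL) (b1 / (2 * sqrt eps)) *
  cpower (l xLL - l xRR) (g1 / (2 * sqrt eps)).

Definition Phi2 (eps : R) (b2 g2 : C) (l : logs) : C :=
  cpower (l xR) (b2 / (2 * sqrt eps) - 1) /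
  cpower (l xL) (b2 / (2 * sqrt eps) + 1) *
  cpower (l xLL - l xRR) (g2 / (2 * sqrt eps)).

Definition is_integer (z : C) : Prop := exists n : Z, z = RtoC (IZR n).

Definition double_resonance (eps : R) (b1 b2 g1 g2 : C) : Prop :=
  is_integer ((b2 - b1) / (2 * sqrt eps)) /\
  is_integer ((g2 - g1) / (2 * sqrt eps)).

(** * Residues and the matrices T_jj *)

Definition is_residue (f : C -> C) (a c : C) : Prop :=
  exists rho : R, (0 < rho)%R /\
  forall r : R, (0 < r < rho)%R ->
    is_RInt (V := C_R_NormedModule)
      (fun t : R => f (a + r * Cexp (Ci * t)) * (Ci * r * Cexp (Ci * t)))
      0 (2 * PI) (2 * PI * Ci * c).

Definition residue (f : C -> C) (a : C) : C :=
  iota (T := C_R_CompleteNormedModule) (is_residue f a).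

Definition mat2 (a b c d : C) : @matrix C 2 2 :=
  mk_matrix 2 2 (fun i j =>
    match i, j with
    | O, O => a | O, _ => b
    | _, O => c | _, _ => d
    end).

(* In double resonance the principal values below may be replaced by any
   others: the quotient is a rational function of x. *)
Definition d_res (eps : R) (b1 b2 g1 g2 : C) (p : sing) : C :=
  residue (fun x => Phi2 eps b2 g2 (principal_logs eps x) /
                    Phi1 eps b1 g1 (principal_logs eps x))
          (sing_point eps p).

Definition Tmat (eps : R) (b1 b2 g1 g2 : C) (p : sing) : @matrix C 2 2 :=
  mat2 0 (d_res eps b1 b2 g1 g2 p) 0 0.

(** * Matrix exponential, scalar multiple and inverse *)

Definition CSeries (a : nat -> C) : C :=
  (Series (fun k => Re (a k)), Series (fun k => Im (a k))).

Definition Mexp {n : nat} (A : @matrix C n n) : @matrix C n n :=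
  mk_matrix n n (fun i j =>
    CSeries (fun k => coeff_mat zero (pow_n A k) i j / INR (fact k))).

Definition Mscal {n : nat} (c : C) (A : @matrix C n n) : @matrix C n n :=
  mk_matrix n n (fun i j => c * coeff_mat zero A i j).

Definition is_inverse {n : nat} (A B : @matrix C n n) : Prop :=
  Mmult A B = Mone /\ Mmult B A = Mone.

(** * The sectorial domains at infinity *)

Definition connected (D : C -> Prop) : Prop :=
  (exists x, D x) /\
  forall U V : C -> Prop, open U -> open V ->
    (forall x, D x -> U x \/ V x) ->
    (forall x, D x -> U x -> V x -> False) ->
    (forall x, D x -> U x) \/ (forall x, D x -> V x).

Definition is_domain (D : C -> Prop) : Prop := open D /\ connected D.

(* {|x| > rho} cut along the real line from x_RR to x_LL through infinity. *)
Definition cut_plane (eps rho : R) (x : C) : Prop :=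
  (rho < Cmod x)%R /\ ~ (Im x = 0 /\ / sqrt eps <= Rabs (Re x))%R.

Definition Omega_RR (D1 D2 : C -> Prop) (x : C) : Prop :=
  D1 x /\ D2 x /\ (0 < Re x)%R.

Definition Omega_LL (D1 D2 : C -> Prop) (x : C) : Prop :=
  D1 x /\ D2 x /\ (Re x < 0)%R.

(* How far the two half-planes extend across the real intervals is left free,
   as long as they meet only in one component on each side of the imaginary
   axis. *)
Record sectorial_pair (eps rho : R) (Up Low : C -> Prop) : Prop := {
  up_domain : is_domain Up;
  low_domain : is_domain Low;
  up_cut : forall x, Up x -> cut_plane eps rho x;
  low_cut : forall x, Low x -> cut_plane eps rho x;
  up_half : forall x, (rho < Cmod x)%R -> (0 < Im x)%R -> Up x;
  low_half : forall x, (rho < Cmod x)%R -> (Im x < 0)%R -> Low x;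
  right_interval : forall t : R, (rho < t < / sqrt eps)%R ->
    Omega_RR Up Low (RtoC t);
  left_interval : forall t : R, (- / sqrt eps < t < - rho)%R ->
    Omega_LL Up Low (RtoC t);
  two_components : forall x, Up x -> Low x ->
    Omega_RR Up Low x \/ Omega_LL Up Low x;
  RR_connected : connected (Omega_RR Up Low);
  LL_connected : connected (Omega_LL Up Low)
}.

(* In double resonance g1 - g2 is real, so its sign is that of its real part. *)
Definition from_RR (g1 g2 : C) : Prop := (0 <= Re (g1 - g2))%R.

Definition Stokes_domains (eps rho : R) (g1 g2 : C) (O1 O2 : C -> Prop) :=
  (from_RR g1 g2 -> sectorial_pair eps rho O1 O2) /\
  (~ from_RR g1 g2 -> sectorial_pair eps rho O2 O1).

Definition is_base_point (eps : R) (g1 g2 : C) (xs : C) : Prop :=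
  (from_RR g1 g2 -> xs = sing_point eps xRR) /\
  (~ from_RR g1 g2 -> xs = sing_point eps xLL).

Definition adjacent (g1 g2 : C) (O1 O2 : C -> Prop) (x : C) : Prop :=
  (from_RR g1 g2 /\ Omega_RR O1 O2 x) \/ (~ from_RR g1 g2 /\ Omega_LL O1 O2 x).

(** * Branches of the fundamental matrix at infinity *)

Definition log_branch (eps : R) (D : C -> Prop) (l : C -> logs) : Prop :=
  forall x, D x -> forall p,
    Cexp (l x p) = sing_factor eps p x /\ continuous (fun z : C => l z p) x.

(* [I] is the integral of [f] from [xs] to [x] along a path which stays in [D]
   except for its starting point [xs], where the integral is improper. *)
Definition is_path_integral (D : C -> Prop) (f : C -> C) (xs x I : C) : Prop :=
  exists path dpath : R -> C,
    filterlim path (at_right 0) (locally xs) /\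
    path 1%R = x /\
    (forall t : R, (0 < t <= 1)%R ->
       D (path t) /\
       is_derive (K := R_AbsRing) (V := C_R_NormedModule) path t (dpath t) /\
       continuous dpath t) /\
    is_RInt_gen (V := C_R_NormedModule)
      (fun t : R => f (path t) * dpath t) (at_right 0) (at_point 1) I.

Definition is_Phi_inf_branch (eps : R) (b1 b2 g1 g2 : C) (xs : C)
    (D : C -> Prop) (l : C -> logs) (Psi : C -> @matrix C 2 2) : Prop :=
  log_branch eps D l /\
  forall x, D x -> exists I : C,
    is_path_integral D
      (fun z => Phi2 eps b2 g2 (l z) / Phi1 eps b1 g1 (l z)) xs x I /\
    Psi x = mat2 (Phi1 eps b1 g1 (l x)) (Phi1 eps b1 g1 (l x) * I)
                 0                      (Phi2 eps b2 g2 (l x)).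

(* [St] is the constant value of Psi1^{-1} Psi2 on [D]. *)
Definition is_Stokes_matrix (D : C -> Prop) (Psi1 Psi2 : C -> @matrix C 2 2)
    (St : @matrix C 2 2) : Prop :=
  forall x, D x -> exists N : @matrix C 2 2,
    is_inverse (Psi1 x) N /\ St = Mmult N (Psi2 x).

(* Main.v *)
Require Import Defs.
From Stdlib Require Import Reals Factorial Lra Lia ZArith.
From Coquelicot Require Import Coquelicot.
Local Open Scope C_scope.

(** In double resonance f = Phi2 / Phi1 is, with p = ±sqrt eps and q the base
    point ±1/sqrt eps, equal to (x-p)^k / (x+p)^(k+2) * ((q-x)/(q+x))^N.
    In the variable u = (x+q)/(x+p) the form f dx is a Laurent polynomial in u
    times du, hence f = c/(x+q) - c/(x+p) + G' with G a rational function that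
    is regular at q.  So the residue of f is c at -q and 0 at q, and on each
    sectorial domain the integral from q is explicit up to the branch of
    log (x+p), i.e. of log x, since (x+p)/x has a principal logarithm there.
    The branches of log x on the two domains differ by 0 on the component
    adjacent to q and by 2 pi i on the other one.  The prefactors Phi1, Phi2
    cause no further jump because (x-sqrt eps)/(x+sqrt eps) and
    (1/sqrt eps+x)/(1/sqrt eps-x) have principal logarithms on the whole cut
    plane. *)

(** * Continuity and derivatives of complex-valued functions *)

(** The logarithms, the paths and the exact shape of the two domains are arbitrary, so no contour
    can be chosen. Each integral is evaluated as the increment of one primitive, single-valued on
    the whole domain and still continuous at q, which lies on the cut and outside the domain. For
    this reason every logarithm is reduced to a principal one whose argument avoids the closed
    negative real axis.

    Signs: p is sqrt eps or its opposite according to the sign of m = (b2 - b1) / (2 sqrt eps), and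
    k = |m| - 1. For m = 0 both inner points would be simple poles; [b1 <> b2] excludes this. The
    sign of (g2 - g1) / (2 sqrt eps) selects q so that the outer factor has no pole there. When q
    moves from the right to the left, the two domains also exchange their roles; the two changes of
    sign cancel, and the jump of the integral away from q is 2 pi i c in both cases. On the side of
    q the residue is 0 and the exponential is the identity. *)

Lemma continuous_C_iff {T : UniformSpace} (f : T -> C) (x : T) :
  continuous (f : T -> C_UniformSpace) x <->
  continuous (fun y => Re (f y)) x /\ continuous (fun y => Im (f y)) x.
Proof.
  split.
  - intros H; split; intros P [e He].
    + apply (H (fun z => P (Re z))). exists e. intros z [Hz _]. apply He, Hz.
    + apply (H (fun z => P (Im z))). exists e. intros z [_ Hz]. apply He, Hz.
  - intros [H1 H2] P [e He].
    assert (K1 := H1 (fun r => ball (Re (f x)) e r) (locally_ball _ e)).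
    assert (K2 := H2 (fun r => ball (Im (f x)) e r) (locally_ball _ e)).
    unfold filtermap in *. generalize (filter_and _ _ K1 K2). apply filter_imp.
    intros y [A B]. apply He. split; assumption.
Qed.

Section ContinuousAlgebra.
Context {T : UniformSpace}.
Implicit Types (f g : T -> C) (x : T).
Let cont f x := continuous (f : T -> C_UniformSpace) x.

Lemma continuous_Cplus f g x :
  cont f x -> cont g x -> cont (fun y => f y + g y) x.
Proof.
  unfold cont; rewrite !continuous_C_iff; intros [] []; split; simpl;
    now apply (continuous_plus (V := R_NormedModule)).
Qed.

Lemma continuous_Cmult f g x :
  cont f x -> cont g x -> cont (fun y => f y * g y) x.
Proof.
  unfold cont; rewrite !continuous_C_iff; intros [] []; split; simpl.
  - apply (continuous_minus (V := R_NormedModule));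
      now apply (continuous_mult (K := R_AbsRing)).
  - apply (continuous_plus (V := R_NormedModule));
      now apply (continuous_mult (K := R_AbsRing)).
Qed.

Lemma continuous_Copp f x : cont f x -> cont (fun y => - f y) x.
Proof.
  unfold cont; rewrite !continuous_C_iff; intros []; split; simpl;
    now apply (continuous_opp (V := R_NormedModule)).
Qed.

Lemma continuous_Cminus f g x :
  cont f x -> cont g x -> cont (fun y => f y - g y) x.
Proof.
  intros; apply continuous_Cplus; [assumption|now apply continuous_Copp].
Qed.

Lemma Re_Im_pos (z : C) : z <> 0 -> (0 < Re z * Re z + Im z * Im z)%R.
Proof.
  intros Hz. destruct z as [a b]; simpl.
  destruct (Req_dec a 0) as [->|Ha]; [|nra].
  destruct (Req_dec b 0) as [->|Hb]; [|nra].
  now exfalso; apply Hz.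
Qed.

Lemma continuous_Cinv f x : f x <> 0 -> cont f x -> cont (fun y => / f y) x.
Proof.
  intros Hf; unfold cont; rewrite !continuous_C_iff; intros [H1 H2].
  assert (Hp := Re_Im_pos _ Hf).
  assert (Hi : continuous (fun y => / (Re (f y) ^ 2 + Im (f y) ^ 2))%R x).
  { apply (continuous_comp (fun y => (Re (f y) ^ 2 + Im (f y) ^ 2)%R) Rinv).
    - simpl.
      apply (continuous_plus (V := R_NormedModule));
        repeat (apply (continuous_mult (K := R_AbsRing)); trivial);
        apply continuous_const.
    - apply continuous_Rinv. simpl. unfold Re, Im in *. nra. }
  split; apply (continuous_mult (K := R_AbsRing)); trivial.
  now apply (continuous_opp (V := R_NormedModule)).
Qed.

Lemma continuous_Cdiv f g x :
  g x <> 0 -> cont f x -> cont g x -> cont (fun y => f y / g y) x.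
Proof.
  intros; apply continuous_Cmult; [assumption|now apply continuous_Cinv].
Qed.

Lemma continuous_Cpow f x (n : nat) : cont f x -> cont (fun y => f y ^ n) x.
Proof.
  intros Hf; induction n as [|n IH]; simpl.
  - apply continuous_const.
  - now apply continuous_Cmult.
Qed.

End ContinuousAlgebra.

(** Functions of a complex variable are differentiated only along curves, so a derivative in a real
    parameter takes the place of complex differentiability. *)
Definition is_deriv (w : R -> C) (t : R) (l : C) : Prop :=
  is_derive (K := R_AbsRing) (V := C_R_NormedModule) w t l.

Lemma is_deriv_iff (w : R -> C) (t : R) (l : C) :
  is_deriv w t l <->
  is_derive (fun s => Re (w s)) t (Re l) /\
  is_derive (fun s => Im (w s)) t (Im l).
Proof.
  split.
  - intros H; split.
    + eapply filterdiff_ext_lin;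
        [apply (filterdiff_comp' (V := C_R_NormedModule) w
                 (fst : C_R_NormedModule -> R_NormedModule) t _ _ H
                 (filterdiff_linear _ is_linear_fst))|].
      reflexivity.
    + eapply filterdiff_ext_lin;
        [apply (filterdiff_comp' (V := C_R_NormedModule) w
                 (snd : C_R_NormedModule -> R_NormedModule) t _ _ H
                 (filterdiff_linear _ is_linear_snd))|].
      reflexivity.
  - intros [H1 H2]. unfold is_deriv, is_derive.
    apply (filterdiff_ext (fun s => (Re (w s), Im (w s)) : C_R_NormedModule)).
    { intros s. now destruct (w s). }
    eapply filterdiff_ext_lin.
    + apply (filterdiff_comp'_2 (W := C_R_NormedModule)
        (fun s => Re (w s)) (fun s => Im (w s))
        (fun a b : R => ((a, b) : C_R_NormedModule)) t _ _ (fun a b => (a, b)) H1 H2).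
      apply filterdiff_linear.
      apply (is_linear_prod (T := prod_NormedModule R_AbsRing R_NormedModule R_NormedModule)).
      * apply is_linear_fst.
      * apply is_linear_snd.
    + intros y; simpl. destruct l; reflexivity.
Qed.

Lemma is_deriv_ext (f g : R -> C) (t : R) (l : C) :
  (forall s, f s = g s) -> is_deriv f t l -> is_deriv g t l.
Proof. apply (is_derive_ext (V := C_R_NormedModule)). Qed.

Lemma is_deriv_const (c : C) (t : R) : is_deriv (fun _ => c) t 0.
Proof. apply (is_derive_const (V := C_R_NormedModule)). Qed.

Lemma is_deriv_plus (f g : R -> C) (t : R) (lf lg : C) :
  is_deriv f t lf -> is_deriv g t lg ->
  is_deriv (fun s => f s + g s) t (lf + lg).
Proof. apply (is_derive_plus (V := C_R_NormedModule)). Qed.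

Lemma is_deriv_mult (f g : R -> C) (t : R) (lf lg : C) :
  is_deriv f t lf -> is_deriv g t lg ->
  is_deriv (fun s => f s * g s) t (lf * g t + f t * lg).
Proof.
  rewrite !is_deriv_iff; intros [Hf1 Hf2] [Hg1 Hg2].
  split; simpl.
  - apply (is_derive_ext (fun s =>
      (Re (f s) * Re (g s) - Im (f s) * Im (g s))%R)); [reflexivity|].
    evar_last.
    + apply (is_derive_minus (V := R_NormedModule));
        apply (is_derive_mult (K := R_AbsRing)); eauto; apply Rmult_comm.
    + unfold minus, plus, opp, mult; simpl. unfold Re, Im. ring.
  - apply (is_derive_ext (fun s =>
      (Re (f s) * Im (g s) + Im (f s) * Re (g s))%R)); [reflexivity|].
    evar_last.
    + apply (is_derive_plus (V := R_NormedModule));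
        apply (is_derive_mult (K := R_AbsRing)); eauto; apply Rmult_comm.
    + unfold minus, plus, opp, mult; simpl. unfold Re, Im. ring.
Qed.

Lemma is_deriv_scal (c : C) (f : R -> C) (t : R) (l : C) :
  is_deriv f t l -> is_deriv (fun s => c * f s) t (c * l).
Proof.
  intros H. replace (c * l) with (0 * f t + c * l) by ring.
  now apply (is_deriv_mult (fun _ => c)); [apply is_deriv_const|].
Qed.

Lemma is_deriv_pow (f : R -> C) (t : R) (l : C) (n : nat) :
  is_deriv f t l ->
  is_deriv (fun s => f s ^ S n) t (RtoC (INR (S n)) * f t ^ n * l).
Proof.
  intros H; induction n as [|n IH].
  - eapply is_deriv_ext; [intros s; simpl; symmetry; apply Cmult_1_r|].
    simpl. now replace (1 * 1 * l) with l by ring.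
  - replace (INR (S (S n)) * f t ^ S n * l)
      with (l * f t ^ S n + f t * (INR (S n) * f t ^ n * l)).
    + now apply (is_deriv_mult f (fun s => f s ^ S n)).
    + rewrite (S_INR (S n)), RtoC_plus. simpl (f t ^ S n). ring.
Qed.

Lemma Csqr_norm_neq0 (z : C) : z <> 0 -> (Re z ^ 2 + Im z ^ 2 <> 0)%R.
Proof. intros H; assert (K := Re_Im_pos _ H); simpl in *; nra. Qed.

Lemma is_deriv_inv (f : R -> C) (t : R) (l : C) :
  f t <> 0 -> is_deriv f t l -> is_deriv (fun s => / f s) t (- l / (f t * f t)).
Proof.
  intros Hf; rewrite !is_deriv_iff; intros [H1 H2].
  assert (Hp := Csqr_norm_neq0 _ Hf).
  set (N := fun s => (Re (f s) ^ 2 + Im (f s) ^ 2)%R).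
  assert (HN : is_derive N t (2 * Re (f t) * Re l + 2 * Im (f t) * Im l)%R).
  { unfold N. evar_last.
    - apply (is_derive_plus (V := R_NormedModule));
        apply is_derive_pow; eassumption.
    - unfold plus; simpl; unfold Re, Im; ring. }
  assert (HI := is_derive_inv N t _ HN Hp).
  assert (Hq : f t * f t <> 0) by now apply Cmult_neq_0.
  assert (Hp2 := Csqr_norm_neq0 _ Hq).
  split.
  - apply (is_derive_ext (fun s => (Re (f s) * / N s)%R)); [reflexivity|].
    evar_last.
    + apply (is_derive_mult (K := R_AbsRing)); [exact H1|exact HI|apply Rmult_comm].
    + unfold plus, mult, N in *; simpl in *. unfold Re, Im in *.
      destruct (f t) as [a b], l as [c d]; simpl in *. field. nra.
  - apply (is_derive_ext (fun s => (- Im (f s) * / N s)%R)); [reflexivity|].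
    evar_last.
    + apply (is_derive_mult (K := R_AbsRing));
        [apply (is_derive_opp (V := R_NormedModule)); exact H2|exact HI|apply Rmult_comm].
    + unfold opp, plus, mult, N in *; simpl in *. unfold Re, Im in *.
      destruct (f t) as [a b], l as [c d]; simpl in *. field. nra.
Qed.

Lemma is_deriv_continuous (w : R -> C) (t : R) (l : C) :
  is_deriv w t l -> continuous (w : R -> C_UniformSpace) t.
Proof.
  intros H. apply (ex_derive_continuous (V := C_R_NormedModule)). now exists l.
Qed.

Lemma is_RInt_deriv (F f : R -> C) (a b : R) :
  (a <= b)%R ->
  (forall t, (a <= t <= b)%R -> is_deriv F t (f t)) ->
  (forall t, (a <= t <= b)%R -> continuous (f : R -> C_UniformSpace) t) ->
  is_RInt (V := C_R_NormedModule) f a b (F b - F a).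
Proof.
  intros Hab HF Hf.
  apply (is_RInt_derive (V := C_R_CompleteNormedModule) F f);
    rewrite Rmin_left, Rmax_right by assumption; assumption.
Qed.

(** * Complex exponential and principal logarithm *)

Lemma C_eq (z w : C) : Re z = Re w -> Im z = Im w -> z = w.
Proof. destruct z, w; simpl; now intros -> ->. Qed.

Lemma Cexp_plus (z w : C) : Cexp (z + w) = Cexp z * Cexp w.
Proof.
  apply C_eq; unfold Re, Im; simpl; unfold Re, Im; simpl; rewrite exp_plus;
    [rewrite cos_plus|rewrite sin_plus]; ring.
Qed.

Lemma Cexp_0 : Cexp 0 = 1.
Proof. apply C_eq; simpl; rewrite exp_0; [rewrite cos_0|rewrite sin_0]; ring. Qed.

Lemma Cexp_opp_l (z : C) : Cexp (- z) * Cexp z = 1.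
Proof. rewrite <- Cexp_plus, <- Cexp_0. f_equal. ring. Qed.

Lemma Cexp_neq0 (z : C) : Cexp z <> 0.
Proof.
  intros H. generalize (Cexp_opp_l z). rewrite H, Cmult_0_r.
  intros E; injection E; lra.
Qed.

Lemma Cexp_opp (z : C) : Cexp (- z) = / Cexp z.
Proof.
  rewrite <- (Cmult_1_r (Cexp (- z))), <- (Cinv_r (Cexp z)) by apply Cexp_neq0.
  rewrite Cmult_assoc, Cexp_opp_l. ring.
Qed.

Lemma Cexp_minus (z w : C) : Cexp (z - w) = Cexp z / Cexp w.
Proof. unfold Cminus; now rewrite Cexp_plus, Cexp_opp. Qed.

Lemma Cexp_INR (n : nat) (z : C) : Cexp (INR n * z) = Cexp z ^ n.
Proof.
  induction n as [|n IH]; [simpl; rewrite Cmult_0_l; apply Cexp_0|].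
  rewrite S_INR, RtoC_plus, Cmult_plus_distr_r, Cexp_plus, IH, Cmult_1_l.
  simpl; ring.
Qed.

(** The periods of the exponential are the multiples of 2 pi i, and the bound on the imaginary parts
    leaves only the period 0. This makes continuous logarithms rigid. *)
Lemma Cexp_near_eq (z w : C) :
  Cexp z = Cexp w -> (Rabs (Im z - Im w) < 2 * PI)%R -> z = w.
Proof.
  intros E H.
  assert (E1 : Cexp (z - w) = 1).
  { rewrite Cexp_minus, E. field. apply Cexp_neq0. }
  set (d := z - w) in *. replace (Im z - Im w)%R with (Im d) in H
    by (unfold d, Im; simpl; ring).
  assert (Ed : d = 0).
  { clearbody d. clear E z w. injection E1; intros B A. destruct d as [a b]; simpl in *.
    assert (HP := PI_RGT_0). assert (He := exp_pos a).
    assert (Hs := sin2_cos2 b). unfold Rsqr in Hs.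
    assert (Ha : exp a = 1%R).
    { assert (exp a * exp a = 1)%R by nra. nra. }
    assert (a = 0)%R by (apply exp_inv; rewrite exp_0; exact Ha). subst a.
    rewrite Ha in A, B.

    (* The half angle turns cos b = 1 into sin (b / 2) = 0 with |b / 2| < pi, where the sine
       vanishes only at 0. *)
    replace b with (2 * (b / 2))%R in A by field.
    rewrite cos_2a_sin in A.
    assert (S0 : (sin (b / 2) = 0)%R) by nra.
    apply Rabs_def2 in H; destruct H as [H1 H2]; simpl in H1, H2.
    destruct (Rtotal_order b 0) as [Hb|[->|Hb]]; [|reflexivity|]; exfalso.
    - assert (S1 : (0 < sin (- (b / 2)))%R) by (apply sin_gt_0; lra).
      rewrite sin_neg in S1. lra.
    - assert (0 < sin (b / 2))%R by (apply sin_gt_0; lra). lra. }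
  replace z with (d + w) by (unfold d; ring). rewrite Ed; ring.
Qed.

(** * Principal logarithm off the negative real axis *)

Definition slit (w : C) : Prop := (0 < Cmod w + Re w)%R.

(* Principal logarithm in half-angle form: smooth wherever [slit] holds, i.e. off
   the closed negative real axis, unlike the [acos] form of [Clog]. *)
Definition plog (w : C) : C :=
  (ln (Cmod w), 2 * atan (Im w / (Cmod w + Re w)))%R.

Lemma Cmod_sqr (w : C) : (Cmod w * Cmod w = Re w * Re w + Im w * Im w)%R.
Proof.
  unfold Cmod. rewrite sqrt_sqrt; unfold Re, Im; [ring|nra].
Qed.

Lemma slit_intro (w : C) : (Im w = 0 -> 0 < Re w)%R -> slit w.
Proof.
  intros H. unfold slit. assert (K := Cmod_sqr w). assert (P := Cmod_ge_0 w).
  destruct (Req_dec (Im w) 0) as [E|E]; [specialize (H E); lra|].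
  nra.
Qed.

Lemma slit_Re_pos (w : C) : (0 < Re w)%R -> slit w.
Proof. now intros; apply slit_intro. Qed.

Lemma slit_near_1 (w : C) : (Cmod w < 1)%R -> slit (1 + w).
Proof.
  intros H. apply slit_Re_pos. simpl.
  assert (K := Rmax_Cmod w). assert (L := Rmax_l (Rabs (fst w)) (Rabs (snd w))).
  assert (M : (Rabs (fst w) < 1)%R) by lra. apply Rabs_def2 in M. simpl. unfold Re. lra.
Qed.

Lemma slit_Cmod_pos (w : C) : slit w -> (0 < Cmod w)%R.
Proof.
  unfold slit; intros H. assert (K := Cmod_sqr w). assert (P := Cmod_ge_0 w). nra.
Qed.

Lemma slit_neq0 (w : C) : slit w -> w <> 0.
Proof.
  intros H; apply slit_Cmod_pos in H. intros ->. rewrite Cmod_0 in H. lra.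
Qed.

(** With t the tangent of half the argument, the cosine and sine of the argument are (1 - t^2) / (1
    + t^2) and 2t / (1 + t^2). *)
Lemma Cexp_plog (w : C) : slit w -> Cexp (plog w) = w.
Proof.
  intros H. assert (Hm := slit_Cmod_pos _ H). assert (K := Cmod_sqr w).
  unfold slit in H.
  unfold plog, Cexp; simpl. rewrite exp_ln by assumption.
  set (r := Cmod w) in *. set (t := (Im w / (r + Re w))%R).
  assert (Hc := cos_atan t). assert (Hs := sin_atan t).
  assert (Ht : (0 < 1 + t²)%R) by (unfold Rsqr; nra).
  assert (Hq : (sqrt (1 + t²) * sqrt (1 + t²) = 1 + t²)%R)
    by (apply sqrt_sqrt; lra).
  assert (Hq0 : (0 < sqrt (1 + t²))%R) by now apply sqrt_lt_R0.
  rewrite cos_2a, sin_2a, Hc, Hs.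
  (* Since r^2 = (Re w)^2 + (Im w)^2, the numerator (r + Re w)^2 + (Im w)^2 equals 2r (r + Re w). *)
  assert (T : (1 + t² = 2 * r / (r + Re w))%R).
  { unfold t, Rsqr.
    replace (1 + Im w / (r + Re w) * (Im w / (r + Re w)))%R
      with (((r + Re w) * (r + Re w) + Im w * Im w) / ((r + Re w) * (r + Re w)))%R
      by (field; lra).
    replace (Im w * Im w)%R with (r * r - Re w * Re w)%R by lra. field; lra. }
  assert (T2 : (t * t = 2 * r / (r + Re w) - 1)%R) by (unfold Rsqr in T; lra).
  apply C_eq; simpl.
  - replace (r * (1 / sqrt (1 + t²) * (1 / sqrt (1 + t²)) -
       t / sqrt (1 + t²) * (t / sqrt (1 + t²))))%R
      with (r * ((1 - t * t) / (sqrt (1 + t²) * sqrt (1 + t²))))%R by (field; lra).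
    rewrite Hq, T, T2. field. lra.
  - replace (r * (2 * (t / sqrt (1 + t²)) * (1 / sqrt (1 + t²))))%R
      with (r * (2 * t / (sqrt (1 + t²) * sqrt (1 + t²))))%R by (field; lra).
    rewrite Hq, T. unfold t. field. lra.
Qed.

Lemma continuous_Cmod (w : C) : continuous (Cmod : C_UniformSpace -> R) w.
Proof.
  assert (Hid : continuous (fun z : C_UniformSpace => (z : C_UniformSpace)) w)
    by apply continuous_id.
  apply continuous_C_iff in Hid. destruct Hid as [HR HI].
  apply (continuous_comp (fun z : C_UniformSpace => (Re z ^ 2 + Im z ^ 2)%R) sqrt);
    [|apply continuous_sqrt].
  apply (continuous_plus (V := R_NormedModule));
    repeat (apply (continuous_mult (K := R_AbsRing)); trivial);
    apply continuous_const.
Qed.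

Lemma continuous_plog (w : C) :
  slit w -> continuous (plog : C_UniformSpace -> C_UniformSpace) w.
Proof.
  intros H. assert (Hm := slit_Cmod_pos _ H). unfold slit in H.
  assert (Hid : continuous (fun z : C_UniformSpace => (z : C_UniformSpace)) w)
    by apply continuous_id.
  apply continuous_C_iff in Hid. destruct Hid as [HR HI].
  assert (HC := continuous_Cmod w).
  apply continuous_C_iff; split; simpl.
  - apply (continuous_comp (Cmod : C_UniformSpace -> R) ln); trivial.
    now apply continuous_ln.
  - apply (continuous_mult (K := R_AbsRing)); [apply continuous_const|].
    apply (continuous_comp (fun z : C_UniformSpace => (Im z / (Cmod z + Re z))%R) atan);
      [|apply continuous_atan].
    apply (continuous_mult (K := R_AbsRing)); trivial.
    apply (continuous_comp (fun z : C_UniformSpace => (Cmod z + Re z)%R) Rinv);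
      [|apply continuous_Rinv; lra].
    now apply (continuous_plus (V := R_NormedModule)).
Qed.

Lemma is_deriv_plog (w : R -> C) (t : R) (l : C) :
  slit (w t) -> is_deriv w t l -> is_deriv (fun s => plog (w s)) t (l / w t).
Proof.
  intros H. assert (Hm := slit_Cmod_pos _ H). assert (K := Cmod_sqr (w t)).
  assert (H0 := slit_neq0 _ H).
  unfold slit in H.
  rewrite !is_deriv_iff; intros [H1 H2].
  set (r := Cmod (w t)) in *.
  assert (HC : is_derive (fun s => Cmod (w s)) t
     ((Re (w t) * Re l + Im (w t) * Im l) / r)%R).
  { unfold Cmod. evar_last.
    - apply is_derive_sqrt.
      + apply (is_derive_plus (V := R_NormedModule)); apply is_derive_pow; eassumption.
      + assert (P := Re_Im_pos _ H0). simpl. unfold Re, Im in *. nra.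
    - change (sqrt _) with r. unfold plus; simpl. unfold Re, Im. field. lra. }
  split.
  - evar_last.
    + apply (is_derive_comp ln (fun s => Cmod (w s))); [|exact HC].
      apply is_derive_ln. exact Hm.
    + unfold scal; simpl; unfold mult; simpl. fold r.
      destruct (w t) as [u v], l as [a b]; simpl in *.
      replace (u * (u * 1) + v * (v * 1))%R with (r * r)%R by (rewrite K; ring).
      field. lra.
  - evar_last.
    + apply is_derive_scal.
      apply (is_derive_comp atan (fun s => Im (w s) / (Cmod (w s) + Re (w s)))%R).
      * apply is_derive_atan.
      * apply is_derive_div; [exact H2| |fold r; lra].
        apply (is_derive_plus (V := R_NormedModule)); [exact HC|exact H1].
    + unfold scal, plus; simpl; unfold mult; simpl. fold r.
      destruct (w t) as [u v], l as [a b]; simpl in *. unfold Rsqr.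
      replace (u * (u * 1) + v * (v * 1))%R with (r * r)%R by (rewrite K; ring).
      replace (1 + v / (r + u) * (v / (r + u)))%R
        with (2 * r / (r + u))%R.
      2:{ apply (Rmult_eq_reg_r ((r + u) * (r + u)));
            [|apply Rgt_not_eq, Rmult_lt_0_compat; lra].
          transitivity ((r + u) * (r + u) + v * v)%R; [|field; lra].
          transitivity (2 * r * (r + u))%R; [field; lra|]. lra. }
      (* Clearing denominators leaves a polynomial identity modulo r^2 = u^2 + v^2. *)
      apply (Rmult_eq_reg_r (r * r * (r + u)));
        [|apply Rgt_not_eq; repeat apply Rmult_lt_0_compat; lra].
      transitivity (b * (r * r) + b * r * u - v * (u * a + v * b) - v * a * r)%R.
      { field. lra. }
      transitivity (((- (a * v)) + b * u) * (r + u))%R; [|field; lra].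
      rewrite K. ring_simplify. rewrite <- ?Rmult_assoc. ring.
Qed.

(** The half-angle tangents of w and -w are t and -1/t with t > 0, and atan t + atan (1/t) = pi/2.
    The jump of log x between the two domains comes from this identity. *)
Lemma plog_opp (w : C) :
  (0 < Im w)%R -> plog w - plog (- w) = PI * Ci.
Proof.
  intros H. unfold plog. rewrite Cmod_opp.
  assert (K := Cmod_sqr w). assert (P := Cmod_ge_0 w).
  set (r := Cmod w) in *.
  assert (A : (0 < r + Re w)%R) by nra.
  assert (B : (0 < r - Re w)%R) by nra.
  apply C_eq; simpl; [ring|].
  change (snd w) with (Im w). change (fst w) with (Re w).
  replace (- Im w / (r + - Re w))%R with (- (/ (Im w / (r + Re w))))%R.
  - rewrite atan_opp, atan_inv; [field|]. now apply Rdiv_lt_0_compat.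
  - unfold Rdiv. rewrite Rinv_mult, Rinv_inv.
    apply (Rmult_eq_reg_r (Im w * (r + - Re w)));
      [|apply Rgt_not_eq, Rmult_lt_0_compat; lra].
    transitivity (- (r * r - Re w * Re w))%R; [field; lra|].
    transitivity (- (Im w * Im w))%R; [lra|field; lra].
Qed.

(** * Primitive of the quotient and path integrals *)

(** The number c is the coefficient of 1/u in g, and G is a primitive of the rest, hence
    single-valued off 0. *)
Definition laurent_primitive (g : C -> C) (c : C) (G : C -> C) : Prop :=
  (forall u : C, u <> 0 -> continuous (G : C_UniformSpace -> C_UniformSpace) u) /\
  forall (w : R -> C) (t : R) (dw : C), w t <> 0 -> is_deriv w t dw ->
    is_deriv (fun s => G (w s)) t ((g (w t) - c / w t) * dw).

Definition has_laurent_primitive (g : C -> C) : Prop :=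
  exists c G, laurent_primitive g c G.

Lemma has_laurent_primitive_ext (g h : C -> C) :
  (forall u : C, u <> 0 -> g u = h u) ->
  has_laurent_primitive g -> has_laurent_primitive h.
Proof.
  intros E (c & G & HG & H). exists c, G; split; trivial.
  intros w t dw Hw Hd. rewrite <- E by assumption. now apply H.
Qed.

Lemma has_laurent_primitive_plus (g h : C -> C) :
  has_laurent_primitive g -> has_laurent_primitive h ->
  has_laurent_primitive (fun u => g u + h u).
Proof.
  intros (c & G & HG & H) (c' & G' & HG' & H').
  exists (c + c'), (fun u => G u + G' u); split.
  - intros u Hu. apply continuous_Cplus; auto.
  - intros w t dw Hw Hd.
    replace ((g (w t) + h (w t) - (c + c') / w t) * dw)
      with ((g (w t) - c / w t) * dw + (h (w t) - c' / w t) * dw)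
      by (field; assumption).
    apply is_deriv_plus; auto.
Qed.

Lemma has_laurent_primitive_scal (a : C) (g : C -> C) :
  has_laurent_primitive g -> has_laurent_primitive (fun u => a * g u).
Proof.
  intros (c & G & HG & H).
  exists (a * c), (fun u => a * G u); split.
  - intros u Hu. apply continuous_Cmult; auto. apply continuous_const.
  - intros w t dw Hw Hd.
    replace ((a * g (w t) - a * c / w t) * dw)
      with (a * ((g (w t) - c / w t) * dw)) by (field; assumption).
    apply is_deriv_scal; auto.
Qed.

Lemma INR_S_neq0 (n : nat) : RtoC (INR (S n)) <> 0.
Proof. intros H; apply RtoC_inj in H; revert H; apply not_0_INR; lia. Qed.

Lemma has_laurent_primitive_pow (n : nat) :
  has_laurent_primitive (fun u => u ^ n).
Proof.
  assert (Hn := INR_S_neq0 n).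
  exists 0, (fun u => / INR (S n) * u ^ S n); split.
  - intros u Hu. apply continuous_Cmult; [apply continuous_const|].
    apply continuous_Cpow, continuous_id.
  - intros w t dw Hw Hd.
    replace ((w t ^ n - 0 / w t) * dw)
      with (/ INR (S n) * (INR (S n) * w t ^ n * dw)) by (field; auto).
    now apply is_deriv_scal, is_deriv_pow.
Qed.

Lemma has_laurent_primitive_inv_pow (n : nat) :
  has_laurent_primitive (fun u => / u ^ n).
Proof.
  destruct n as [|[|n]].
  - apply (has_laurent_primitive_ext (fun u => u ^ 0)).
    + intros; simpl; field.
    + apply has_laurent_primitive_pow.
  (* The exponent -1 is the only one that contributes to c. *)
  - exists 1, (fun _ => 0); split.
    + intros; apply continuous_const.
    + intros w t dw Hw Hd.
      replace ((/ w t ^ 1 - 1 / w t) * dw) with (RtoC 0)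
        by (simpl; field; assumption).
      apply is_deriv_const.
  - assert (Hn := INR_S_neq0 n).
    exists 0, (fun u => - / INR (S n) * / u ^ S n); split.
    + intros u Hu. apply continuous_Cmult; [apply continuous_const|].
      apply continuous_Cinv; [now apply Cpow_nz|].
      apply continuous_Cpow, continuous_id.
    + intros w t dw Hw Hd.
      assert (Hp := Cpow_nz _ n Hw).
      replace ((/ w t ^ S (S n) - 0 / w t) * dw)
        with (- / INR (S n) * (- (INR (S n) * w t ^ n * dw)
               / (w t ^ S n * w t ^ S n))).
      * apply is_deriv_scal.
        apply (is_deriv_inv (fun s => w s ^ S n)); [now apply Cpow_nz|].
        now apply is_deriv_pow.
      * simpl (_ ^ S _). field. auto.
Qed.

(** Carrying all monomial multiples of g, with positive and negative exponents, makes the induction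
    close: the term b u shifts the exponent by one, and at n = 0 it passes from the negative family
    to the positive one. *)
Lemma has_laurent_primitive_mult_linear (a b : C) (g : C -> C) :
  (forall n, has_laurent_primitive (fun u => u ^ n * g u) /\
             has_laurent_primitive (fun u => g u / u ^ n)) ->
  forall n, has_laurent_primitive (fun u => u ^ n * ((a + b * u) * g u)) /\
            has_laurent_primitive (fun u => (a + b * u) * g u / u ^ n).
Proof.
  intros H n; split.
  - apply (has_laurent_primitive_ext
      (fun u => a * (u ^ n * g u) + b * (u ^ S n * g u))).
    + intros u Hu; simpl; ring.
    + apply has_laurent_primitive_plus; apply has_laurent_primitive_scal, H.
  - destruct n as [|n].
    + apply (has_laurent_primitive_ext
        (fun u => a * (u ^ 0 * g u) + b * (u ^ 1 * g u))).
      * intros u Hu; simpl; field.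
      * apply has_laurent_primitive_plus; apply has_laurent_primitive_scal, H.
    + apply (has_laurent_primitive_ext
        (fun u => a * (g u / u ^ S n) + b * (g u / u ^ n))).
      * intros u Hu; assert (Hp := Cpow_nz _ n Hu); simpl; field; auto.
      * apply has_laurent_primitive_plus; apply has_laurent_primitive_scal, H.
Qed.

Lemma has_laurent_primitive_mult_linear_pow (a b : C) (g : C -> C) (k : nat) :
  (forall n, has_laurent_primitive (fun u => u ^ n * g u) /\
             has_laurent_primitive (fun u => g u / u ^ n)) ->
  forall n, has_laurent_primitive (fun u => u ^ n * ((a + b * u) ^ k * g u)) /\
            has_laurent_primitive (fun u => (a + b * u) ^ k * g u / u ^ n).
Proof.
  intros H; induction k as [|k IH]; intros n.
  - destruct (H n) as [H1 H2]; split;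
      [revert H1|revert H2]; apply has_laurent_primitive_ext; intros u Hu; simpl;
      unfold Cdiv; ring.
  - destruct (has_laurent_primitive_mult_linear a b _ IH n) as [H1 H2]; split;
      [revert H1|revert H2]; apply has_laurent_primitive_ext; intros u Hu; simpl;
      unfold Cdiv; ring.
Qed.

(** * The quotient in the coordinate u *)

Lemma Cinv_neq0 (z : C) : z <> 0 -> / z <> 0.
Proof.
  intros Hz E. apply C1_nz. rewrite <- (Cinv_r z Hz), E. ring.
Qed.

Definition quotient (p q : C) (k N : nat) (x : C) : C :=
  (x - p) ^ k / (x + p) ^ (k + 2) * ((q - x) / (q + x)) ^ N.

Lemma quotient_continuous (p q : C) (k N : nat) (x : C) :
  x + p <> 0 -> x + q <> 0 ->
  continuous (quotient p q k N : C_UniformSpace -> C_UniformSpace) x.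
Proof.
  intros Hp Hq. unfold quotient.
  assert (Hid := continuous_id (x : C_UniformSpace)).
  assert (Hc := fun c : C_UniformSpace =>
    continuous_const (U := C_UniformSpace) c (x : C_UniformSpace)).
  apply continuous_Cmult; [apply continuous_Cdiv|apply continuous_Cpow, continuous_Cdiv].
  - now apply Cpow_nz.
  - now apply continuous_Cpow, continuous_Cminus.
  - now apply continuous_Cpow, continuous_Cplus.
  - now rewrite Cplus_comm.
  - now apply continuous_Cminus.
  - now apply continuous_Cplus.
Qed.

(** The logarithmic part is subtracted rather than integrated, so that the same c and G serve the
    small circles around the outer points and both sectorial domains, each with its own branch of
    the logarithms. *)
Definition quotient_log_primitive (p q : C) (k N : nat) (c : C) (G : C -> C) : Prop :=
  (forall z : C, z + p <> 0 -> z + q <> 0 ->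
     continuous (G : C_UniformSpace -> C_UniformSpace) z) /\
  forall (w : R -> C) (t : R) (dw : C),
    w t + p <> 0 -> w t + q <> 0 -> is_deriv w t dw ->
    is_deriv (fun s => G (w s)) t
      ((quotient p q k N (w t) - c * (/ (w t + q) - / (w t + p))) * dw).

(* With u = (x + q) / (x + p), quotient p q k N x dx is a Laurent polynomial
   in u times du, so its only residues are those of c du / u. *)
Lemma quotient_primitive (p q : C) (k N : nat) :
  p <> q ->
  exists (c : C) (G : C -> C), quotient_log_primitive p q k N c G.
Proof.
  intros Hpq.
  assert (Hd : q - p <> 0) by (intros E; apply Hpq; symmetry; now apply Ceq_minus).
  set (e := / (q - p)).
  assert (H1 : forall n, has_laurent_primitive (fun u => u ^ n * 1) /\
                         has_laurent_primitive (fun u => 1 / u ^ n)).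
  { intros n; split.
    - generalize (has_laurent_primitive_pow n).
      apply has_laurent_primitive_ext; intros; ring.
    - generalize (has_laurent_primitive_inv_pow n).
      apply has_laurent_primitive_ext; intros; unfold Cdiv; ring. }
  (* As 1 / (x + p) = e (u - 1), the constants here are those of (q - x) / (x + p) as an affine
     function of u, and the ones below those of (x - p) / (x + p). The power u^N in the denominator
     comes from (q + x)^N. *)
  assert (H2 := has_laurent_primitive_mult_linear_pow
    (- (2 * q * e)) (2 * q * e - 1) _ N H1).
  assert (H3 := has_laurent_primitive_mult_linear_pow
    (1 + 2 * p * e) (- (2 * p * e)) _ k H2 N).
  (* The factor -e is the Jacobian: du = (p - q) dx / (x + p)^2. *)
  destruct H3 as [_ H3]. apply (has_laurent_primitive_scal (- e)) in H3.
  destruct H3 as (c & G & HG & HD). cbv beta in HD.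
  assert (Hu0 : forall z : C, z + p <> 0 -> z + q <> 0 -> (z + q) / (z + p) <> 0).
  { intros z Hp Hq. apply Cmult_neq_0; trivial. now apply Cinv_neq0. }
  exists c, (fun z => G ((z + q) / (z + p))); split.
  - intros z Hp Hq.
    assert (Hid := continuous_id (z : C_UniformSpace)).
    assert (Hc := fun c : C_UniformSpace =>
      continuous_const (U := C_UniformSpace) c (z : C_UniformSpace)).
    apply (continuous_comp (fun z : C_UniformSpace => (z + q) / (z + p) : C_UniformSpace)
      (G : C_UniformSpace -> C_UniformSpace)).
    + now apply continuous_Cdiv; [|apply continuous_Cplus|apply continuous_Cplus].
    + apply HG. now apply Hu0.
  - intros w t dw Hp Hq Hw.
    assert (Hdu : is_deriv (fun s => (w s + q) / (w s + p)) t
       ((p - q) / ((w t + p) * (w t + p)) * dw)).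
    { replace ((p - q) / ((w t + p) * (w t + p)) * dw)
        with ((dw + 0) * / (w t + p) + (w t + q) * (- (dw + 0) / ((w t + p) * (w t + p))))
        by (field; assumption).
      apply (is_deriv_mult (fun s => w s + q) (fun s => / (w s + p))).
      - apply is_deriv_plus; [assumption|apply is_deriv_const].
      - apply (is_deriv_inv (fun s => w s + p)); [assumption|].
        apply is_deriv_plus; [assumption|apply is_deriv_const]. }
    specialize (HD (fun s => (w s + q) / (w s + p)) t _ (Hu0 _ Hp Hq) Hdu).
    cbv beta in HD.
    match type of HD with is_deriv _ _ ?a =>
      match goal with |- is_deriv _ _ ?b => replace b with a; [exact HD|] end end.
    set (z := w t) in *. unfold quotient, e.
    replace (1 + 2 * p * / (q - p) + - (2 * p * / (q - p)) * ((z + q) / (z + p)))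
      with ((z - p) / (z + p)) by (field; auto).
    replace (- (2 * q * / (q - p)) + (2 * q * / (q - p) - 1) * ((z + q) / (z + p)))
      with ((q - z) / (z + p)) by (field; auto).
    assert (Hq' : q + z <> 0) by now rewrite Cplus_comm.
    unfold Cdiv. rewrite !Cpow_mult_l, Cpow_add_r, !Cpow_inv by assumption.
    assert (Hkp := Cpow_nz _ k Hp). assert (Hnp := Cpow_nz _ N Hp).
    assert (Hnq := Cpow_nz _ N Hq).
    rewrite (Cplus_comm q z). simpl (_ ^ 2).
    field. repeat split; auto.
Qed.

(** On [t, 1] the path stays in D and the integral is F x - F (path t); continuity of F at [xs]
    alone allows t to tend to 0. The function h replaces f, which depends on the branch and is
    controlled only on D. *)
Lemma path_integral_eq (D : C -> Prop) (f h F : C -> C) (xs x I : C) :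
  is_path_integral D f xs x I ->
  (forall z, D z -> f z = h z) ->
  (forall z : C, D z -> continuous (h : C_UniformSpace -> C_UniformSpace) z) ->
  (forall (w : R -> C) t dw, D (w t) -> is_deriv w t dw ->
     is_deriv (fun s => F (w s)) t (h (w t) * dw)) ->
  continuous (F : C_UniformSpace -> C_UniformSpace) xs ->
  I = F x - F xs.
Proof.
  intros (path & dpath & Hlim & H1 & Hpath & HI) Hfh Hh HF HFc.
  assert (Hint : forall t, (0 < t < 1)%R ->
    is_RInt (V := C_R_NormedModule) (fun t => f (path t) * dpath t) t 1
      (F x - F (path t))).
  { intros t Ht. rewrite <- H1.
    apply (is_RInt_ext (V := C_R_NormedModule) (fun t => h (path t) * dpath t)).
    - intros s Hs. rewrite Rmin_left, Rmax_right in Hs by lra.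
      rewrite Hfh; trivial. apply Hpath. lra.
    - apply (is_RInt_deriv (fun s => F (path s))); [lra| |].
      + intros s Hs. destruct (Hpath s) as (A & B & _); [lra|]. now apply HF.
      + intros s Hs. destruct (Hpath s) as (A & B & E); [lra|].
        apply continuous_Cmult; trivial.
        apply (continuous_comp (path : R_UniformSpace -> C_UniformSpace)
          (h : C_UniformSpace -> C_UniformSpace)).
        * eapply is_deriv_continuous, B.
        * now apply Hh. }
  (* The improper integral is a limit along pairs of end points; freezing the second one at 1 leaves
     a limit in t alone. *)
  assert (L1 : filterlim (fun t => F x - F (path t)) (at_right 0)
                 (locally (T := C_UniformSpace) I)).
  { intros P HP. specialize (HI P HP).
    destruct HI as [Q S HQ HS HQS].
    assert (H01 : at_right 0 (fun t => 0 < t < 1)%R).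
    { exists (mkposreal 1 Rlt_0_1). intros y Hy Hy0. split; trivial.
      unfold ball in Hy; simpl in Hy. unfold AbsRing_ball, abs, minus, plus, opp in Hy; simpl in Hy.
      apply Rabs_def2 in Hy. lra. }
    unfold filtermap. generalize (filter_and _ _ HQ H01). apply filter_imp.
    intros t [Qt Ht]. destruct (HQS t 1%R Qt HS) as (y & Hy & Py).
    simpl in Hy.
    replace (F x - F (path t)) with y; trivial.
    rewrite <- (is_RInt_unique (V := C_R_CompleteNormedModule) _ _ _ _ Hy).
    now apply (is_RInt_unique (V := C_R_CompleteNormedModule)), Hint. }
  assert (L2 : filterlim (fun t => F x - F (path t)) (at_right 0)
                 (locally (T := C_UniformSpace) (F x - F xs))).
  { apply (filterlim_comp _ _ _ path (fun z => F x - F z) _ (locally (T := C_UniformSpace) xs));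
      trivial.
    apply (continuous_Cminus (T := C_UniformSpace) (fun _ => F x) F); trivial.
    apply continuous_const. }
  apply (filterlim_locally_unique (V := C_R_NormedModule) _ _ _ L1 L2).
Qed.

(** * Residues *)

Lemma Cexp_Ci (t : R) : Cexp (Ci * t) = (cos t, sin t).
Proof.
  unfold Cexp. simpl.
  replace (0 * t - 1 * 0)%R with 0%R by ring.
  replace (0 * 0 + 1 * t)%R with t by ring.
  rewrite exp_0. f_equal; ring.
Qed.

Lemma is_deriv_circle (a : C) (r t : R) :
  is_deriv (fun t : R => a + r * Cexp (Ci * t)) t (Ci * r * Cexp (Ci * t)).
Proof.
  replace (Ci * r * Cexp (Ci * t)) with (0 + r * (Ci * Cexp (Ci * t))) by ring.
  apply is_deriv_plus; [apply is_deriv_const|apply is_deriv_scal].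
  apply (is_deriv_ext (fun t => (cos t, sin t))).
  { intros s; now rewrite Cexp_Ci. }
  rewrite Cexp_Ci, is_deriv_iff; split; simpl; auto_derive; trivial; ring.
Qed.

Lemma Cmod_Cexp_Ci (t : R) : Cmod (Cexp (Ci * t)) = 1%R.
Proof.
  rewrite Cexp_Ci. unfold Cmod; simpl.
  replace (cos t * (cos t * 1) + sin t * (sin t * 1))%R with 1%R.
  - apply sqrt_1.
  - generalize (sin2_cos2 t); unfold Rsqr; intros; lra.
Qed.

Lemma Cexp_2PI : Cexp (Ci * (2 * PI)%R) = Cexp (Ci * 0).
Proof.
  rewrite !Cexp_Ci, cos_2PI, sin_2PI, cos_0, sin_0. reflexivity.
Qed.

(** Two candidates share the integral over any circle smaller than both of their radii. *)
Lemma residue_unique (f : C -> C) (a c : C) : is_residue f a c -> residue f a = c.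
Proof.
  intros H. apply (iota_unique (V := C_R_CompleteNormedModule)); [|exact H].
  intros y (r1 & P1 & H1). destruct H as (r2 & P2 & H2).
  set (r := (Rmin r1 r2 / 2)%R).
  assert (Hr : (0 < r < r1 /\ r < r2)%R).
  { unfold r. assert (Rmin r1 r2 <= r1)%R by apply Rmin_l.
    assert (Rmin r1 r2 <= r2)%R by apply Rmin_r.
    assert (0 < Rmin r1 r2)%R by (apply Rmin_pos; trivial). lra. }
  assert (K1 := H1 r (conj (proj1 (proj1 Hr)) (proj2 (proj1 Hr)))).
  assert (K2 := H2 r (conj (proj1 (proj1 Hr)) (proj2 Hr))).
  apply (is_RInt_unique (V := C_R_CompleteNormedModule)) in K1.
  apply (is_RInt_unique (V := C_R_CompleteNormedModule)) in K2.
  rewrite K1 in K2.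
  assert (HP : 2 * PI * Ci <> 0).
  { intros E. injection E. assert (Hpi := PI_RGT_0). intros; lra. }
  change (2 * PI * Ci * y = 2 * PI * Ci * c) in K2. change (y = c :> C).
  set (K := 2 * PI * Ci) in *.
  rewrite <- (Cmult_1_l y), <- (Cmult_1_l c), <- (Cinv_l _ HP), <- !Cmult_assoc.
  now rewrite K2.
Qed.

(** Factoring z + (b - a) as b (1 + (z - a) / b) gives a logarithm that is principal on the disc |z
    - a| < |b|; the constant log b drops out of the derivative. *)
Lemma is_deriv_plog_affine (w : R -> C) (t : R) (dw a b : C) :
  b <> 0 -> slit (1 + (w t - a) / b) -> is_deriv w t dw ->
  is_deriv (fun s => plog (1 + (w s - a) / b)) t (/ (w t + (b - a)) * dw).
Proof.
  intros Hb Hs Hw. assert (H0 := slit_neq0 _ Hs).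
  assert (H1 : w t + (b - a) <> 0).
  { intros E. apply H0. replace (1 + (w t - a) / b) with ((w t + (b - a)) / b)
      by (field; auto). rewrite E. unfold Cdiv; ring. }
  replace (/ (w t + (b - a)) * dw) with (/ b * (dw + 0) / (1 + (w t - a) / b)).
  2:{ field. repeat split; trivial. }
  apply (is_deriv_plog (fun s => 1 + (w s - a) / b)); trivial.
  replace (/ b * (dw + 0)) with (0 + / b * (dw + 0)) by ring.
  apply is_deriv_plus; [apply is_deriv_const|].
  apply (is_deriv_ext (fun s => / b * (w s + - a))).
  { intros; unfold Cdiv, Cminus; ring. }
  apply is_deriv_scal, is_deriv_plus; [trivial|apply is_deriv_const].
Qed.

Lemma affine_neq0 (z a b : C) :
  b <> 0 -> slit (1 + (z - a) / b) -> z + (b - a) <> 0.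
Proof.
  intros Hb Hs E. apply (slit_neq0 _ Hs).
  replace (1 + (z - a) / b) with ((z + (b - a)) / b) by (field; auto).
  rewrite E. unfold Cdiv; ring.
Qed.

Lemma slit_circle (a b : C) (r t : R) :
  (0 < r < Cmod b)%R -> slit (1 + (a + r * Cexp (Ci * t) - a) / b).
Proof.
  intros Hr. apply slit_near_1.
  assert (Hb : b <> 0) by (apply Cmod_gt_0; lra).
  replace (a + r * Cexp (Ci * t) - a) with (r * Cexp (Ci * t)) by ring.
  rewrite Cmod_div, Cmod_mult, Cmod_Cexp_Ci, Cmod_R, Rabs_pos_eq by (trivial; lra).
  apply (Rmult_lt_reg_r (Cmod b)); [lra|]. field_simplify; lra.
Qed.

(** The primitive F is a function of the angle, not of the point, so it need not be periodic: its
    increment over one turn is where a residue shows. *)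
Lemma circle_integral (f h : C -> C) (F : R -> C) (a : C) (r : R) :
  (forall t : R, f (a + r * Cexp (Ci * t)) = h (a + r * Cexp (Ci * t))) ->
  (forall t : R, continuous (h : C_UniformSpace -> C_UniformSpace)
                   (a + r * Cexp (Ci * t))) ->
  (forall t : R, is_deriv F t
     (h (a + r * Cexp (Ci * t)) * (Ci * r * Cexp (Ci * t)))) ->
  is_RInt (V := C_R_NormedModule)
    (fun t : R => f (a + r * Cexp (Ci * t)) * (Ci * r * Cexp (Ci * t)))
    0 (2 * PI) (F (2 * PI)%R - F 0%R).
Proof.
  intros Hfh Hh HF.
  apply (is_RInt_ext (V := C_R_NormedModule)
    (fun t : R => h (a + r * Cexp (Ci * t)) * (Ci * r * Cexp (Ci * t)))).
  { intros t _. now rewrite Hfh. }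
  assert (HP := PI_RGT_0).
  apply (is_RInt_deriv F); [lra|intros; apply HF|].
  intros t _.
  assert (Hc := is_deriv_continuous _ _ _ (is_deriv_circle a r t)).
  assert (Hc0 := is_deriv_continuous _ _ _ (is_deriv_circle 0 r t)).
  apply continuous_Cmult.
  - apply (continuous_comp (fun t : R_UniformSpace => a + r * Cexp (Ci * t) : C_UniformSpace)
      (h : C_UniformSpace -> C_UniformSpace)); trivial.
  - apply (continuous_ext (fun t : R_UniformSpace =>
      Ci * (0 + r * Cexp (Ci * t)) : C_UniformSpace)).
    { intros s; match goal with |- ?u = ?v => change (u = v :> C) end; ring. }
    apply (continuous_Cmult (T := R_UniformSpace) (fun _ => Ci)); trivial.
    apply continuous_const.
Qed.

Lemma Cmod_circle (a : C) (r t : R) :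
  (0 < r)%R -> Cmod (a + r * Cexp (Ci * t) - a) = r.
Proof.
  intros Hr.
  replace (a + r * Cexp (Ci * t) - a) with (r * Cexp (Ci * t)) by ring.
  rewrite Cmod_mult, Cmod_Cexp_Ci, Cmod_R, Rabs_pos_eq by lra. ring.
Qed.

(** The points -q and -p are at distances |2q| and |q + p| from q. Inside that range both logarithms
    are principal along the circle, so the primitive closes up. *)
Lemma residue_at_base (f : C -> C) (p q : C) (k N : nat) (c : C) (G : C -> C)
    (rho : R) :
  quotient_log_primitive p q k N c G ->
  (0 < rho <= Cmod (2 * q))%R -> (rho <= Cmod (q + p))%R ->
  (forall z, (0 < Cmod (z - q) < rho)%R -> f z = quotient p q k N z) ->
  residue f q = 0.
Proof.
  intros [HGc HG] Hq Hqp Hf.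
  apply residue_unique. exists rho; split; [lra|]. intros r Hr.
  set (F := fun t : R => G (q + r * Cexp (Ci * t)) +
    c * (plog (1 + (q + r * Cexp (Ci * t) - q) / (2 * q)) +
         - (1) * plog (1 + (q + r * Cexp (Ci * t) - q) / (q + p)))).
  assert (S1 : forall t : R, slit (1 + (q + r * Cexp (Ci * t) - q) / (2 * q)))
    by (intros; apply slit_circle; lra).
  assert (S2 : forall t : R, slit (1 + (q + r * Cexp (Ci * t) - q) / (q + p)))
    by (intros; apply slit_circle; lra).
  assert (N1 : 2 * q <> 0) by (apply Cmod_gt_0; lra).
  assert (N2 : q + p <> 0) by (apply Cmod_gt_0; lra).
  assert (E1 : 2 * q - q = q) by ring.
  assert (E2 : q + p - q = p) by ring.
  assert (Z1 : forall t : R, q + r * Cexp (Ci * t) + q <> 0).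
  { intros t. generalize (affine_neq0 _ _ _ N1 (S1 t)). now rewrite E1. }
  assert (Z2 : forall t : R, q + r * Cexp (Ci * t) + p <> 0).
  { intros t. generalize (affine_neq0 _ _ _ N2 (S2 t)). now rewrite E2. }
  replace (2 * PI * Ci * 0) with (F (2 * PI)%R - F 0%R).
  2:{ unfold F. rewrite Cexp_2PI. ring. }
  apply (circle_integral f (quotient p q k N)).
  - intros t. apply Hf. rewrite Cmod_circle; lra.
  - intros t. now apply quotient_continuous.
  - intros t. assert (D := is_deriv_circle q r t).
    assert (D1 := is_deriv_plog_affine _ _ _ _ _ N1 (S1 t) D).
    assert (D2 := is_deriv_plog_affine _ _ _ _ _ N2 (S2 t) D).
    rewrite E1 in D1. rewrite E2 in D2. cbv beta in D1, D2.
    set (z := q + r * Cexp (Ci * t)) in *. set (dz := Ci * r * Cexp (Ci * t)) in *.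
    replace (quotient p q k N z * dz)
      with ((quotient p q k N z - c * (/ (z + q) - / (z + p))) * dz +
            c * (/ (z + q) * dz + - (1) * (/ (z + p) * dz))) by ring.
    apply is_deriv_plus.
    + apply (HG (fun t : R => q + r * Cexp (Ci * t))); [apply Z2|apply Z1|exact D].
    + apply is_deriv_scal, is_deriv_plus; [exact D1|apply is_deriv_scal; exact D2].
Qed.

(** Around -q one has dz / (z + q) = i dt, so i t stands for log (z + q) and gains 2 pi i over one
    turn, while log (z + p) and G return to their initial values. *)
Lemma residue_at_pole (f : C -> C) (p q : C) (k N : nat) (c : C) (G : C -> C)
    (rho : R) :
  quotient_log_primitive p q k N c G ->
  (0 < rho <= Cmod (p - q))%R ->
  (forall z, (0 < Cmod (z - - q) < rho)%R -> f z = quotient p q k N z) ->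
  residue f (- q) = c.
Proof.
  intros [HGc HG] Hq Hf.
  apply residue_unique. exists rho; split; [lra|]. intros r Hr.
  set (F := fun t : R => G (- q + r * Cexp (Ci * t)) +
    c * (Ci * t +
         - (1) * plog (1 + (- q + r * Cexp (Ci * t) - - q) / (p - q)))).
  assert (S2 : forall t : R, slit (1 + (- q + r * Cexp (Ci * t) - - q) / (p - q)))
    by (intros; apply slit_circle; lra).
  assert (N2 : p - q <> 0) by (apply Cmod_gt_0; lra).
  assert (E2 : p - q - - q = p) by ring.
  assert (Nr : RtoC r <> 0) by (intros E; apply RtoC_inj in E; lra).
  assert (Z1 : forall t : R, - q + r * Cexp (Ci * t) + q <> 0).
  { intros t. replace (- q + r * Cexp (Ci * t) + q) with (r * Cexp (Ci * t)) by ring.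
    apply Cmult_neq_0; [trivial|apply Cexp_neq0]. }
  assert (Z2 : forall t : R, - q + r * Cexp (Ci * t) + p <> 0).
  { intros t. generalize (affine_neq0 _ _ _ N2 (S2 t)). now rewrite E2. }
  replace (2 * PI * Ci * c) with (F (2 * PI)%R - F 0%R).
  2:{ unfold F. rewrite Cexp_2PI, RtoC_mult. ring. }
  apply (circle_integral f (quotient p q k N)).
  - intros t. apply Hf. rewrite Cmod_circle; lra.
  - intros t. now apply quotient_continuous.
  - intros t. assert (D := is_deriv_circle (- q) r t).
    assert (D2 := is_deriv_plog_affine _ _ _ _ _ N2 (S2 t) D).
    rewrite E2 in D2. cbv beta in D2.
    assert (D1 : is_deriv (fun t : R => Ci * t) t Ci).
    { apply is_deriv_iff; simpl; split; auto_derive; trivial; ring. }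
    set (dz := Ci * r * Cexp (Ci * t)) in *.
    assert (D1' : / (- q + r * Cexp (Ci * t) + q) * dz = Ci).
    { replace (- q + r * Cexp (Ci * t) + q) with (r * Cexp (Ci * t)) by ring.
      unfold dz. field. split; [apply Cexp_neq0|trivial]. }
    set (z := - q + r * Cexp (Ci * t)) in *.
    replace (quotient p q k N z * dz)
      with ((quotient p q k N z - c * (/ (z + q) - / (z + p))) * dz +
            c * (/ (z + q) * dz + - (1) * (/ (z + p) * dz))) by ring.
    rewrite D1'.
    apply is_deriv_plus.
    + apply (HG (fun t : R => - q + r * Cexp (Ci * t))); [apply Z2|apply Z1|exact D].
    + apply is_deriv_scal, is_deriv_plus; [exact D1|apply is_deriv_scal; exact D2].
Qed.

(** * Branches of logarithms and matrices *)

(** By continuity, nearby values of h differ by less than 2 pi in imaginary part, so h is locally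
    constant. The set where h takes the value h x and its complement in D are then both open. *)
Lemma connected_log_eq (D : C -> Prop) (h : C -> C) :
  is_domain D ->
  (forall x : C, D x -> continuous (h : C_UniformSpace -> C_UniformSpace) x) ->
  (forall x y : C, D x -> D y -> Cexp (h x) = Cexp (h y)) ->
  forall x y : C, D x -> D y -> h x = h y.
Proof.
  intros [Dopen [_ Dconn]] Hc He x y Hx Hy.
  assert (Hloc : forall z, D z -> locally (T := C_UniformSpace) z (fun z' => D z' /\ h z' = h z)).
  { intros z Hz.
    assert (HP : (0 < 2 * PI)%R) by (generalize PI_RGT_0; lra).
    assert (K := Hc z Hz (fun v => ball (M := C_UniformSpace) (h z) (mkposreal _ HP) v)
                  (locally_ball (T := C_UniformSpace) _ (mkposreal _ HP))).
    unfold filtermap in K.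
    generalize (filter_and _ _ K (Dopen z Hz)). apply filter_imp.
    intros z' [[_ B] Hz']. split; trivial.
    apply Cexp_near_eq; [now apply He|exact B]. }
  destruct (Dconn (fun z => D z /\ h z = h x) (fun z => D z /\ h z <> h x)) as [A|A].
  - intros z [Hz Ez]. generalize (Hloc z Hz). apply filter_imp.
    intros z' [? E']; split; trivial; congruence.
  - intros z [Hz Ez]. generalize (Hloc z Hz). apply filter_imp.
    intros z' [? E']; split; trivial; congruence.
  - intros z Hz. destruct (Classical_Prop.classic (h z = h x)); auto.
  - intros z _ [_ E1] [_ E2]; auto.
  - symmetry; now apply A.
  - now destruct (A x Hx).
Qed.

(** * Two-by-two matrices and the exponential of a nilpotent one *)

Lemma Mult_mat2 (a b c d a' b' c' d' : C) :
  Mmult (mat2 a b c d) (mat2 a' b' c' d') =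
  mat2 (a * a' + b * c') (a * b' + b * d') (c * a' + d * c') (c * b' + d * d').
Proof.
  unfold Mmult, mat2. apply mk_matrix_ext. intros [|[|i]] [|[|j]] Hi Hj; try lia;
    simpl pred; rewrite sum_Sn, sum_O; reflexivity.
Qed.

Lemma Mone_mat2 : (Mone : @matrix C 2 2) = mat2 1 0 0 1.
Proof. reflexivity. Qed.

Lemma CSeries_le_1 (a : nat -> C) :
  (forall k, a (S (S k)) = 0) -> CSeries a = a 0%nat + a 1%nat.
Proof.
  intros H.
  assert (K : forall b : nat -> R, (forall k, b (S (S k)) = 0%R) ->
    Series b = (b 0%nat + b 1%nat)%R).
  { intros b Hb. apply is_series_unique.
    apply (is_series_decr_1 (V := R_NormedModule)), (is_series_decr_1 (V := R_NormedModule)).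
    apply (is_series_ext (V := R_NormedModule) (fun _ => 0%R)); [intros; now rewrite Hb|].
    evar_last; [apply (filterlim_ext (fun _ => 0%R));
      [|apply filterlim_const]|].
    - intros n. symmetry. induction n as [|n IH]; [apply sum_O|].
      rewrite sum_Sn, IH. apply Rplus_0_l.
    - unfold plus, opp; simpl. ring. }
  unfold CSeries. rewrite !K by (intros; now rewrite H). reflexivity.
Qed.

Lemma Mexp_nilpotent (d : C) : Mexp (mat2 0 d 0 0) = mat2 1 d 0 1.
Proof.
  assert (H : forall k, pow_n (mat2 0 d 0 0) (S (S k)) = mat2 0 0 0 0).
  { induction k as [|k IH].
    - change (pow_n (mat2 0 d 0 0) 2)
        with (Mmult (mat2 0 d 0 0) (Mmult (mat2 0 d 0 0) Mone)).
      rewrite Mone_mat2, !Mult_mat2. f_equal; ring.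
    - change (pow_n (mat2 0 d 0 0) (S (S (S k))))
        with (Mmult (mat2 0 d 0 0) (pow_n (mat2 0 d 0 0) (S (S k)))).
      rewrite IH, Mult_mat2. f_equal; ring. }
  assert (H1 : pow_n (mat2 0 d 0 0) 1 = mat2 0 d 0 0).
  { change (pow_n (mat2 0 d 0 0) 1) with (Mmult (mat2 0 d 0 0) Mone).
    rewrite Mone_mat2, Mult_mat2. f_equal; ring. }
  unfold Mexp. unfold mat2 at 2. apply mk_matrix_ext.
  intros i j Hi Hj.
  rewrite CSeries_le_1.
  - rewrite H1. change (pow_n (mat2 0 d 0 0) 0) with (Mone : @matrix C 2 2).
    rewrite Mone_mat2. simpl (INR (fact _)).
    unfold mat2; rewrite !coeff_mat_bij by assumption.
    destruct i as [|[|i]], j as [|[|j]]; try lia; field; apply C1_nz.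
  - intros k. rewrite H. unfold mat2; rewrite coeff_mat_bij by assumption.
    destruct i, j; unfold Cdiv; ring.
Qed.

Lemma Mscal_mat2 (c d : C) : Mscal c (mat2 0 d 0 0) = mat2 0 (c * d) 0 0.
Proof.
  unfold Mscal. apply mk_matrix_ext. intros i j Hi Hj.
  unfold mat2; rewrite coeff_mat_bij by assumption.
  destruct i, j; ring.
Qed.

(** This makes the principal values used in the residues an admissible choice of logarithms,
    although [Clog] is not continuous on the negative axis. *)
Lemma Cexp_Clog (z : C) : z <> 0 -> Cexp (Clog z) = z.
Proof.
  intros Hz. assert (Hm := proj1 (Cmod_gt_0 z) Hz). assert (K := Cmod_sqr z).
  assert (B : (-1 <= Re z / Cmod z <= 1)%R).
  { split; apply (Rmult_le_reg_r (Cmod z)); trivial; unfold Rdiv;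
      rewrite Rmult_assoc, Rinv_l; nra. }
  assert (S : (sin (acos (Re z / Cmod z)) = Rabs (Im z) / Cmod z)%R).
  { rewrite sin_acos by assumption.
    replace (1 - (Re z / Cmod z)²)%R with ((Im z / Cmod z)²)%R.
    - rewrite sqrt_Rsqr_abs, Rabs_div, (Rabs_pos_eq (Cmod z)); lra.
    - unfold Rsqr. apply (Rmult_eq_reg_r (Cmod z * Cmod z)); [|nra].
      transitivity (Im z * Im z)%R; [field; lra|].
      transitivity (Cmod z * Cmod z - Re z * Re z)%R; [lra|field; lra]. }
  unfold Cexp, Clog, Arg. simpl. rewrite exp_ln by assumption.
  destruct (Rle_dec 0 (Im z)) as [H|H].
  - rewrite cos_acos, S, Rabs_pos_eq by assumption.
    apply C_eq; simpl; field; lra.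
  - rewrite cos_neg, sin_neg, cos_acos, S, Rabs_left by (trivial; lra).
    apply C_eq; simpl; field; lra.
Qed.

(** * The cut plane *)

(** The two expressions are the imaginary and real parts of z times the conjugate of w, a positive
    multiple of z / w. *)
Lemma slit_Cdiv (z w : C) :
  w <> 0 ->
  (Im z * Re w - Re z * Im w = 0 -> 0 < Re z * Re w + Im z * Im w)%R ->
  slit (z / w).
Proof.
  intros Hw H. assert (P := Re_Im_pos _ Hw).
  assert (ER : (Re (z / w) = (Re z * Re w + Im z * Im w) /
                 (Re w * Re w + Im w * Im w))%R).
  { destruct z, w; simpl in *; field; nra. }
  assert (EI : (Im (z / w) = (Im z * Re w - Re z * Im w) /
                 (Re w * Re w + Im w * Im w))%R).
  { destruct z, w; simpl in *; field; nra. }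
  apply slit_intro. rewrite ER, EI. intros E.
  apply Rdiv_lt_0_compat; trivial. apply H.
  apply (Rmult_eq_reg_r (/ (Re w * Re w + Im w * Im w))).
  - unfold Rdiv in E. rewrite E; ring.
  - apply Rinv_neq_0_compat. lra.
Qed.

Section Domains.
Variables (eps rho : R).
Hypothesis Heps : (0 < eps < 1)%R.
Hypothesis Hrho : (sqrt eps < rho < / sqrt eps)%R.
Let s := sqrt eps.

Lemma sqrt_eps_bounds : (0 < s < 1 /\ s < / s)%R.
Proof.
  assert (0 < s)%R by (apply sqrt_lt_R0; lra).
  assert (s * s = eps)%R by (apply sqrt_sqrt; lra).
  assert (s < 1)%R by nra.
  split; [lra|]. fold s in Hrho; lra.
Qed.

Lemma factors_neq0 (x : C) :
  cut_plane eps rho x -> forall p, sing_factor eps p x <> 0.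
Proof.
  intros [Hx Hc]. destruct sqrt_eps_bounds as [Hs Hs'].
  fold s in Hrho, Hc.
  assert (K := Cmod_sqr x).
  intros p E; destruct p; simpl in E; fold s in E;
    assert (E1 := f_equal Re E); assert (E2 := f_equal Im E); simpl in E1, E2;
    unfold Re, Im in *.
  - assert (snd x = 0)%R by lra. assert (fst x = - s)%R by lra. nra.
  - assert (snd x = 0)%R by lra. assert (fst x = s)%R by lra. nra.
  - apply Hc. split; [lra|]. replace (fst x) with (- / s)%R by lra.
    rewrite Rabs_Ropp, Rabs_pos_eq; lra.
  - apply Hc. split; [lra|]. replace (fst x) with (/ s)%R by lra.
    rewrite Rabs_pos_eq; lra.
Qed.

(** The product of x - s with the conjugate of x + s has real part |x|^2 - s^2, positive because |x|
    > rho > s. *)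
Lemma slit_inner_ratio (x : C) :
  cut_plane eps rho x -> slit (sing_factor eps xR x / sing_factor eps xL x).
Proof.
  intros Hx. apply slit_Cdiv; [now apply factors_neq0|]. intros _.
  destruct Hx as [Hx _]. assert (K := Cmod_sqr x). destruct sqrt_eps_bounds as [Hs _].
  fold s in Hrho. simpl; fold s. unfold Re, Im in *. nra.
Qed.

(** The product of 1/s + x with the conjugate of 1/s - x is 1/s^2 - |x|^2 + 2i Im x / s. It is real
    only for real x, and then positive off the cut. *)
Lemma slit_outer_ratio (x : C) :
  cut_plane eps rho x -> slit (sing_factor eps xLL x / sing_factor eps xRR x).
Proof.
  intros Hx. apply slit_Cdiv; [now apply factors_neq0|].
  destruct Hx as [_ Hx]. destruct sqrt_eps_bounds as [Hs Hs'].
  simpl; fold s. fold s in Hx. unfold Re, Im in *. intros E.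
  assert (Ey : snd x = 0%R) by nra.
  rewrite Ey in *.
  assert (Ha : (Rabs (fst x) < / s)%R).
  { apply Rnot_le_lt. intros L. now apply Hx. }
  apply Rabs_def2 in Ha. nra.
Qed.

(** * Branches of the logarithms and of Phi1, Phi2 on a domain *)

Section Branch.
Variables (D : C -> Prop) (l : C -> logs).
Hypothesis HD : is_domain D.
Hypothesis Dcut : forall x, D x -> cut_plane eps rho x.
Hypothesis Hl : log_branch eps D l.

Lemma sing_factor_continuous (p : sing) (x : C) :
  continuous (sing_factor eps p : C_UniformSpace -> C_UniformSpace) x.
Proof.
  assert (Hid := continuous_id (x : C_UniformSpace)).
  assert (Hc := fun c : C_UniformSpace =>
    continuous_const (U := C_UniformSpace) c (x : C_UniformSpace)).
  destruct p; simpl;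
    try exact (continuous_Cminus (T := C_UniformSpace) _ _ x Hid (Hc _));
    exact (continuous_Cminus (T := C_UniformSpace) _ _ x (Hc _) Hid).
Qed.

(** The difference l p - l p' and the principal logarithm of the ratio are continuous logarithms of
    the same function, so they differ by a constant on the connected domain. *)
Lemma log_branch_ratio (p p' : sing) (x x0 : C) :
  (forall y, D y -> slit (sing_factor eps p y / sing_factor eps p' y)) ->
  D x -> D x0 ->
  l x p - l x p' = l x0 p - l x0 p' +
    (plog (sing_factor eps p x / sing_factor eps p' x) -
     plog (sing_factor eps p x0 / sing_factor eps p' x0)).
Proof.
  intros Hs Hx Hx0.
  set (g := fun y => sing_factor eps p y / sing_factor eps p' y).
  assert (E := connected_log_eq D (fun y => l y p - l y p' - plog (g y)) HD).
  replace (l x p - l x p') with (l x p - l x p' - plog (g x) + plog (g x)) by ring.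
  rewrite E with (y := x0); trivial.
  - unfold g. ring.
  - intros y Hy.
    apply (continuous_Cminus (T := C_UniformSpace));
      [apply (continuous_Cminus (T := C_UniformSpace)); now apply Hl|].
    apply (continuous_comp (g : C_UniformSpace -> C_UniformSpace)
             (plog : C_UniformSpace -> C_UniformSpace)).
    + apply (continuous_Cdiv (T := C_UniformSpace)); try apply sing_factor_continuous.
      now apply factors_neq0, Dcut.
    + now apply continuous_plog, Hs.
  - assert (F : forall y, D y -> Cexp (l y p - l y p' - plog (g y)) = 1).
    { intros y Hy. assert (Hn := factors_neq0 y (Dcut y Hy)).
      rewrite !Cexp_minus, Cexp_plog by now apply Hs.
      destruct (Hl y Hy p) as [-> _]. destruct (Hl y Hy p') as [-> _].
      unfold g. field. auto. }
    intros y y' Hy Hy'. now rewrite !F.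
Qed.

End Branch.

Definition monodromy_free (B Ga x : C) : C :=
  Cexp (B * plog (sing_factor eps xR x / sing_factor eps xL x) +
        Ga * plog (sing_factor eps xLL x / sing_factor eps xRR x)).

(** Comparing with a reference point x0 removes the unknown constant of the branch: the growth
    factor from x0 to x is the same for every domain and every choice of logarithms. *)
Lemma Phi1_factor (D : C -> Prop) (l : C -> logs) (b g x x0 : C) :
  is_domain D -> (forall y, D y -> cut_plane eps rho y) -> log_branch eps D l ->
  D x -> D x0 ->
  Phi1 eps b g (l x) = Phi1 eps b g (l x0) *
    (monodromy_free (b / (2 * s)) (g / (2 * s)) x /
     monodromy_free (b / (2 * s)) (g / (2 * s)) x0).
Proof.
  intros HD Dc Hl Hx Hx0. unfold Phi1, cpower, monodromy_free.
  rewrite <- !Cexp_plus, <- Cexp_minus, <- Cexp_plus.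
  rewrite (log_branch_ratio D l HD Dc Hl xR xL x x0) by
    (trivial; intros; now apply slit_inner_ratio, Dc).
  rewrite (log_branch_ratio D l HD Dc Hl xLL xRR x x0) by
    (trivial; intros; now apply slit_outer_ratio, Dc).
  f_equal. unfold s. ring.
Qed.

Lemma Phi2_expand (b g : C) (l : logs) :
  Phi2 eps b g l = Cexp (b / (2 * s) * (l xR - l xL) + g / (2 * s) * (l xLL - l xRR))
    * (/ Cexp (l xR) * / Cexp (l xL)).
Proof.
  unfold Phi2, cpower, Cdiv at 1. rewrite <- !Cexp_opp, <- !Cexp_plus.
  f_equal. unfold s. ring.
Qed.

Lemma Phi1_expand (b g : C) (l : logs) :
  Phi1 eps b g l = Cexp (b / (2 * s) * (l xR - l xL) + g / (2 * s) * (l xLL - l xRR)).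
Proof. unfold Phi1, cpower. now rewrite <- Cexp_plus. Qed.

(** The extra factor is 1 / ((x - sqrt eps)(x + sqrt eps)) whatever the logarithms, so statements
    about branches of [Phi2] reduce to [Phi1]. *)
Lemma Phi2_Phi1 (b g : C) (l : logs) :
  Phi2 eps b g l = Phi1 eps b g l * (/ Cexp (l xR) * / Cexp (l xL)).
Proof. now rewrite Phi2_expand, Phi1_expand. Qed.

(** Agreement at one common point propagates to every common point, even in the other component of
    the intersection, since both branches have the same growth factor. *)
Lemma Phi_coincide (D1 D2 : C -> Prop) (l1 l2 : C -> logs) (b1 g1 b2 g2 x x0 : C) :
  is_domain D1 -> (forall y, D1 y -> cut_plane eps rho y) -> log_branch eps D1 l1 ->
  is_domain D2 -> (forall y, D2 y -> cut_plane eps rho y) -> log_branch eps D2 l2 ->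
  D1 x0 -> D2 x0 -> D1 x -> D2 x ->
  Phi1 eps b1 g1 (l1 x0) = Phi1 eps b1 g1 (l2 x0) ->
  Phi2 eps b2 g2 (l1 x0) = Phi2 eps b2 g2 (l2 x0) ->
  Phi1 eps b1 g1 (l1 x) = Phi1 eps b1 g1 (l2 x) /\
  Phi2 eps b2 g2 (l1 x) = Phi2 eps b2 g2 (l2 x).
Proof.
  intros A1 B1 L1 A2 B2 L2 H1 H2 X1 X2 E1 E2. split.
  - rewrite (Phi1_factor D1 l1 b1 g1 x x0), (Phi1_factor D2 l2 b1 g1 x x0) by trivial.
    now rewrite E1.
  - assert (E3 : Phi1 eps b2 g2 (l1 x0) = Phi1 eps b2 g2 (l2 x0)).
    { rewrite !Phi2_Phi1 in E2.
      destruct (L1 x0 H1 xR) as [R1 _]. destruct (L1 x0 H1 xL) as [R2 _].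
      destruct (L2 x0 H2 xR) as [R3 _]. destruct (L2 x0 H2 xL) as [R4 _].
      rewrite R1, R2, R3, R4 in E2.
      assert (N := factors_neq0 x0 (B1 x0 H1)).
      set (u := sing_factor eps xR x0) in *. set (v := sing_factor eps xL x0) in *.
      assert (Nu : u <> 0) by apply N. assert (Nv : v <> 0) by apply N.
      transitivity (Phi1 eps b2 g2 (l1 x0) * (/ u * / v) * (u * v)); [field; auto|].
      rewrite E2. field; auto. }
    rewrite !Phi2_Phi1.
    rewrite (Phi1_factor D1 l1 b2 g2 x x0), (Phi1_factor D2 l2 b2 g2 x x0) by trivial.
    destruct (L1 x X1 xR) as [-> _]. destruct (L1 x X1 xL) as [-> _].
    destruct (L2 x X2 xR) as [-> _]. destruct (L2 x X2 xL) as [-> _].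
    now rewrite E3.
Qed.

(** The ratio is ((x - s) / (x + s))^m ((1/s + x) / (1/s - x))^n / ((x - s)(x + s)). The signs of m
    and n are absorbed into p and q, which leaves exponents in [nat]. *)
Lemma quotient_form (b1 b2 g1 g2 : C) :
  b1 <> b2 -> double_resonance eps b1 b2 g1 g2 ->
  exists (p : R) (k N : nat), (p = s \/ p = - s)%R /\
  forall q : R, (from_RR g1 g2 -> q = / s)%R -> (~ from_RR g1 g2 -> q = - / s)%R ->
  forall (x : C) (l : logs), (forall j, Cexp (l j) = sing_factor eps j x) ->
    Phi2 eps b2 g2 l / Phi1 eps b1 g1 l = quotient p q k N x.
Proof.
  intros Hb [[m Hm] [n Hn]]. destruct sqrt_eps_bounds as [Hs _].
  assert (Ns : RtoC s <> 0) by (intros E; apply RtoC_inj in E; lra).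
  assert (N2 : 2 * s <> 0).
  { rewrite <- RtoC_mult. intros E; apply RtoC_inj in E; lra. }
  fold s in Hm, Hn.
  (* A nonzero m makes |m| - 1 a genuine subtraction in [nat]. *)
  assert (Hm0 : m <> 0%Z).
  { intros ->. apply Hb. symmetry. apply Ceq_minus.
    transitivity ((b2 - b1) / (2 * s) * (2 * s)); [field; auto|].
    rewrite Hm. ring. }
  (* Since g1 - g2 = -2 n s, the choice of the base point is the choice of the sign of n. *)
  assert (Hfrom : from_RR g1 g2 <-> (n <= 0)%Z).
  { unfold from_RR.
    replace (g1 - g2) with (RtoC (- IZR n * (2 * s))).
    - simpl. split.
      + intros H. apply le_IZR. nra.
      + intros H. apply IZR_le in H. nra.
    - rewrite RtoC_mult, RtoC_opp, <- Hn, RtoC_mult. field; auto. }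
  assert (EQ : forall l : logs, Phi2 eps b2 g2 l / Phi1 eps b1 g1 l =
    Cexp (IZR m * (l xR - l xL)) * Cexp (IZR n * (l xLL - l xRR)) *
    (/ Cexp (l xR) * / Cexp (l xL))).
  { intros l. rewrite Phi2_expand, Phi1_expand, <- Hm, <- Hn.
    unfold Cdiv at 1. rewrite <- !Cexp_opp, <- !Cexp_plus. f_equal. field; auto. }
  (* The factor 1 / ((x - p)(x + p)) lowers the exponent of x - p from |m| to k = |m| - 1 and makes
     that of x + p in the denominator |m| + 1 = k + 2. *)
  exists (if Z_lt_le_dec 0 m then s else - s)%R,
    (Z.abs_nat m - 1)%nat, (Z.abs_nat n).
  split; [destruct (Z_lt_le_dec 0 m); auto|].
  intros q Hq1 Hq2 x l Hl.
  rewrite EQ.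
  assert (NF : forall j, sing_factor eps j x <> 0) by
    (intros j; rewrite <- Hl; apply Cexp_neq0).
  assert (ECexp : forall (z : Z) (a b : sing), (0 <= z)%Z ->
    Cexp (IZR z * (l a - l b)) =
    (sing_factor eps a x / sing_factor eps b x) ^ Z.abs_nat z).
  { intros z a b Hz. rewrite <- !Hl, <- Cexp_minus, <- Cexp_INR.
    rewrite INR_IZR_INZ. now rewrite Zabs2Nat.id_abs, Z.abs_eq. }
  assert (EcexpN : forall (z : Z) (a b : sing), (z <= 0)%Z ->
    Cexp (IZR z * (l a - l b)) =
    (sing_factor eps b x / sing_factor eps a x) ^ Z.abs_nat z).
  { intros z a b Hz. replace (Z.abs_nat z) with (Z.abs_nat (- z)) by lia.
    rewrite <- ECexp by lia.
    f_equal. rewrite opp_IZR, RtoC_opp. ring. }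
  unfold quotient.
  assert (EN : Cexp (IZR n * (l xLL - l xRR)) = ((q - x) / (q + x)) ^ Z.abs_nat n).
  { assert (A : x - (- / s)%R <> 0) by apply (NF xLL).
    assert (B : (/ s)%R - x <> 0) by apply (NF xRR).
    destruct (Z_lt_le_dec 0 n) as [L|L].
    - rewrite ECexp by lia. f_equal.
      rewrite Hq2 by (rewrite Hfrom; lia). simpl; fold s.
      rewrite RtoC_opp in A |- *. set (y := RtoC (/ s)) in *.
      assert (B' : - y + x <> 0).
      { intros E; apply B. replace (y - x) with (- (- y + x)) by ring.
        rewrite E; ring. }
      field; auto.
    - rewrite EcexpN by lia. f_equal.
      rewrite Hq1 by (now rewrite Hfrom). simpl; fold s.
      rewrite RtoC_opp in A |- *. set (y := RtoC (/ s)) in *.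
      f_equal. ring. }
  rewrite EN, !Hl.
  assert (A : x - (- s)%R <> 0) by apply (NF xL).
  assert (B : x - s <> 0) by apply (NF xR).
  destruct (Z_lt_le_dec 0 m) as [L|L].
  - rewrite ECexp by lia. simpl; fold s.
    destruct (Z.abs_nat m) as [|k] eqn:Ek; [lia|].
    replace (S k - 1)%nat with k by lia.
    rewrite RtoC_opp in *.
    replace (x + s) with (x - - s) by ring.
    unfold Cdiv. rewrite Cpow_mult_l, Cpow_inv, Cpow_add_r by trivial.
    assert (Hk := Cpow_nz _ k A). simpl. field. auto.
  - rewrite EcexpN by lia. simpl; fold s.
    destruct (Z.abs_nat m) as [|k] eqn:Ek; [lia|].
    replace (S k - 1)%nat with k by lia.
    replace (x + (- s)%R) with (x - s) by (rewrite RtoC_opp; ring).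
    unfold Cdiv. rewrite Cpow_mult_l, Cpow_inv, Cpow_add_r by trivial.
    assert (Hk := Cpow_nz _ k B). simpl. field. auto.
Qed.

(** * Explicit primitive on a sectorial domain *)

Section Primitive.
Variables (p q : R) (k N : nat) (c : C) (G : C -> C).
Hypothesis Hp : (p = s \/ p = - s)%R.
Hypothesis Hq : (q = / s \/ q = - / s)%R.
Hypothesis HG : quotient_log_primitive p q k N c G.

(** These conditions hold on the cut plane and also at q, which lies on the cut; the primitive has
    to be continuous there. *)
Let regular (z : C) : Prop := z <> 0 /\ slit (1 + z / q) /\ slit (1 + p / z).

Lemma base_neq0 : RtoC q <> 0.
Proof.
  destruct sqrt_eps_bounds as [Hs _]. assert (0 < / s)%R by (apply Rinv_0_lt_compat; lra).
  intros E; apply RtoC_inj in E. destruct Hq; lra.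
Qed.

Lemma regular_neq0 (z : C) : regular z -> z + p <> 0 /\ z + q <> 0.
Proof.
  assert (H0 := base_neq0).
  intros (H1 & H2 & H3). apply slit_neq0 in H2, H3. split; intros E.
  - apply H3. transitivity ((z + p) / z); [field; trivial|]. rewrite E; unfold Cdiv; ring.
  - apply H2. transitivity ((z + q) / q); [field; trivial|]. rewrite E; unfold Cdiv; ring.
Qed.

Lemma slit_1_plus_div (z : C) : (s < Cmod z)%R -> slit (1 + p / z).
Proof.
  intros Hz. destruct sqrt_eps_bounds as [Hs _].
  assert (N0 : z <> 0) by (apply Cmod_gt_0; lra).
  apply slit_near_1. rewrite Cmod_div by trivial. rewrite Cmod_R.
  replace (Rabs p) with s.
  - apply (Rmult_lt_reg_r (Cmod z)); [lra|]. field_simplify; lra.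
  - destruct Hp as [-> | ->]; rewrite ?Rabs_Ropp, Rabs_pos_eq; lra.
Qed.

(** The value 1 + z / q is real and at most 0 only on the real ray from -q away from 0, which
    belongs to the cut. *)
Lemma cut_plane_regular (z : C) : cut_plane eps rho z -> regular z.
Proof.
  intros [Hz Hc]. destruct sqrt_eps_bounds as [Hs Hs']. fold s in Hrho, Hc.
  repeat split.
  - apply Cmod_gt_0; lra.
  - apply slit_intro.
    assert (Hqi : (q <> 0)%R) by (intros E; apply base_neq0; now rewrite E).
    assert (E : 1 + z / q = ((1 + Re z / q)%R, (Im z / q)%R)).
    { unfold Cdiv. rewrite <- RtoC_inv by assumption.
      destruct z as [a b]; apply C_eq; simpl; field; assumption. }
    rewrite E. simpl. intros E1.
    assert (E2 : Im z = 0%R).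
    { replace (Im z) with (Im z / q * q)%R by (field; assumption). rewrite E1; ring. }
    assert (Ha : (Rabs (Re z) < / s)%R).
    { apply Rnot_le_lt. intros L. now apply Hc. }
    apply Rabs_def2 in Ha. destruct Ha as [Ha1 Ha2].
    assert (S1 : (/ s * s = 1)%R) by (apply Rinv_l; lra).
    destruct Hq as [-> | ->].
    + replace (Re z / / s)%R with (Re z * s)%R by (field; lra). nra.
    + replace (Re z / - / s)%R with (- (Re z * s))%R by (field; lra). nra.
  - apply slit_1_plus_div. lra.
Qed.

Lemma base_regular : regular q.
Proof.
  destruct sqrt_eps_bounds as [Hs Hs']. assert (H0 := base_neq0). repeat split; trivial.
  - apply slit_Re_pos. replace (1 + q / q) with (RtoC 2); [simpl; lra|].
    replace (q / q) with (RtoC 1) by (field; trivial). now rewrite <- RtoC_plus.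
  - apply slit_1_plus_div. rewrite Cmod_R.
    destruct Hq as [-> | ->]; rewrite ?Rabs_Ropp, Rabs_pos_eq; lra.
Qed.

(** Up to constants, log (z + p) is log (1 + p / z) + log z. The rotation tau is -i on the upper
    domain and i on the lower one: it turns the half-plane into Re > 0, where the principal
    logarithm applies. Only this term depends on the domain. *)
Definition cut_primitive (tau z : C) : C :=
  G z + c * (plog (1 + z / q) + - (1) * (plog (1 + p / z) + plog (tau * z))).

Lemma cut_primitive_continuous (tau z : C) :
  regular z -> slit (tau * z) ->
  continuous (cut_primitive tau : C_UniformSpace -> C_UniformSpace) z.
Proof.
  intros Hz Ht. destruct (regular_neq0 z Hz) as [Z1 Z2].
  destruct Hz as (Z0 & S1 & S2).
  assert (Hid := continuous_id (z : C_UniformSpace)).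
  assert (Hc := fun c : C_UniformSpace =>
    continuous_const (U := C_UniformSpace) c (z : C_UniformSpace)).
  assert (HL : forall g : C -> C, slit (g z) ->
    continuous (g : C_UniformSpace -> C_UniformSpace) z ->
    continuous (fun y : C_UniformSpace => plog (g y) : C_UniformSpace) z).
  { intros g Hs Hg. apply (continuous_comp (g : C_UniformSpace -> C_UniformSpace)
      (plog : C_UniformSpace -> C_UniformSpace)); trivial. now apply continuous_plog. }
  apply (continuous_Cplus (T := C_UniformSpace)); [now apply (proj1 HG)|].
  apply (continuous_Cmult (T := C_UniformSpace)); trivial.
  apply (continuous_Cplus (T := C_UniformSpace)).
  - apply (HL (fun z => 1 + z / q)); trivial.
    apply (continuous_Cplus (T := C_UniformSpace)); trivial.
    apply (continuous_Cmult (T := C_UniformSpace)); trivial.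
  - apply (continuous_Cmult (T := C_UniformSpace)); trivial.
    apply (continuous_Cplus (T := C_UniformSpace)).
    + apply (HL (fun z => 1 + p / z)); trivial.
      apply (continuous_Cplus (T := C_UniformSpace)); trivial.
      apply (continuous_Cdiv (T := C_UniformSpace)); trivial.
    + apply (HL (fun z => tau * z)); trivial.
      apply (continuous_Cmult (T := C_UniformSpace)); trivial.
Qed.

Lemma is_deriv_cut_primitive (tau : C) (w : R -> C) (t : R) (dw : C) :
  regular (w t) -> slit (tau * w t) -> is_deriv w t dw ->
  is_deriv (fun t => cut_primitive tau (w t)) t (quotient p q k N (w t) * dw).
Proof.
  intros Hz Ht Hw. destruct (regular_neq0 _ Hz) as [Z1 Z2].
  destruct Hz as (Z0 & S1 & S2). assert (H0 := base_neq0).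
  assert (D1 : is_deriv (fun t => plog (1 + w t / q)) t (/ (w t + q) * dw)).
  { replace (/ (w t + q) * dw) with ((0 + / q * dw) / (1 + w t / q)).
    - apply (is_deriv_plog (fun t => 1 + w t / q)); trivial.
      apply is_deriv_plus; [apply is_deriv_const|].
      apply (is_deriv_ext (fun t => / q * w t)); [intros; apply Cmult_comm|].
      now apply is_deriv_scal.
    - field. repeat split; trivial. }
  assert (D2 : is_deriv (fun t => plog (1 + p / w t)) t
     (- p * / (w t * (w t + p)) * dw)).
  { replace (- p * / (w t * (w t + p)) * dw)
      with ((0 + p * (- dw / (w t * w t))) / (1 + p / w t)) by (field; auto).
    apply (is_deriv_plog (fun t => 1 + p / w t)); trivial.
    apply is_deriv_plus; [apply is_deriv_const|].
    now apply is_deriv_scal, is_deriv_inv. }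
  assert (D3 : is_deriv (fun t => plog (tau * w t)) t (/ w t * dw)).
  { assert (NT : tau <> 0).
    { intros E. apply (slit_neq0 _ Ht). rewrite E; ring. }
    replace (/ w t * dw) with (tau * dw / (tau * w t)) by (field; auto).
    apply (is_deriv_plog (fun t => tau * w t)); trivial.
    now apply is_deriv_scal. }
  replace (quotient p q k N (w t) * dw) with
    ((quotient p q k N (w t) - c * (/ (w t + q) - / (w t + p))) * dw +
     c * (/ (w t + q) * dw +
       - (1) * (- p * / (w t * (w t + p)) * dw + / w t * dw))) by (field; auto).
  apply is_deriv_plus; [now apply (proj2 HG)|].
  apply is_deriv_scal, is_deriv_plus; trivial.
  now apply is_deriv_scal, is_deriv_plus.
Qed.

Lemma domain_integral (D : C -> Prop) (f : C -> C) (tau x I : C) :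
  (forall z, D z -> cut_plane eps rho z) ->
  (forall z, D z -> slit (tau * z)) -> slit (tau * q) ->
  (forall z, D z -> f z = quotient p q k N z) ->
  is_path_integral D f q x I ->
  I = cut_primitive tau x - cut_primitive tau q.
Proof.
  intros Dc Dt Tq Hf HI.
  apply (path_integral_eq D f (quotient p q k N)); trivial.
  - intros z Hz. apply quotient_continuous; now apply regular_neq0, cut_plane_regular, Dc.
  - intros w t dw Hz Hw. apply is_deriv_cut_primitive; trivial.
    + now apply cut_plane_regular, Dc.
    + now apply Dt.
  - apply cut_primitive_continuous; trivial. apply base_regular.
Qed.

End Primitive.

(** The rotated point can meet the closed negative axis only if z is on the negative imaginary axis.
    Such a z would also be in the lower domain, and the intersection avoids the imaginary axis. *)
Lemma up_slit (Up Low : C -> Prop) (z : C) :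
  sectorial_pair eps rho Up Low -> Up z -> slit (- Ci * z).
Proof.
  intros H Hz. apply slit_intro. simpl. intros E.
  assert (E0 : Re z = 0%R) by (unfold Re; lra).
  destruct (up_cut _ _ _ _ H z Hz) as [Hr _].
  assert (K := Cmod_sqr z). destruct sqrt_eps_bounds as [Hs _]. fold s in Hrho.
  destruct (Rtotal_order (Im z) 0) as [L|[L|L]].
  - assert (HL := low_half _ _ _ _ H z Hr L).
    destruct (two_components _ _ _ _ H z Hz HL) as [(_ & _ & A)|(_ & _ & A)]; lra.
  - rewrite E0, L in K. nra.
  - unfold Im in L. lra.
Qed.

Lemma low_slit (Up Low : C -> Prop) (z : C) :
  sectorial_pair eps rho Up Low -> Low z -> slit (Ci * z).
Proof.
  intros H Hz. apply slit_intro. simpl. intros E.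
  assert (E0 : Re z = 0%R) by (unfold Re; lra).
  destruct (low_cut _ _ _ _ H z Hz) as [Hr _].
  assert (K := Cmod_sqr z). destruct sqrt_eps_bounds as [Hs _]. fold s in Hrho.
  destruct (Rtotal_order (Im z) 0) as [L|[L|L]].
  - unfold Im in L. lra.
  - rewrite E0, L in K. nra.
  - assert (HL := up_half _ _ _ _ H z Hr L).
    destruct (two_components _ _ _ _ H z HL Hz) as [(_ & _ & A)|(_ & _ & A)]; lra.
Qed.

End Domains.

(** The rotated logarithms differ by -pi i on the right and, in the next lemma, by pi i on the left;
    the gap between the two sides is the full period 2 pi i. *)
Lemma plog_rotated_right (z : C) :
  (0 < Re z)%R -> plog (- Ci * z) - plog (Ci * z) = - (PI * Ci).
Proof.
  intros H. assert (E := plog_opp (Ci * z)).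
  replace (- Ci * z) with (- (Ci * z)) by ring.
  rewrite <- E; [ring|]. simpl. unfold Re in H. lra.
Qed.

Lemma plog_rotated_left (z : C) :
  (Re z < 0)%R -> plog (- Ci * z) - plog (Ci * z) = PI * Ci.
Proof.
  intros H. assert (E := plog_opp (- Ci * z)).
  replace (Ci * z) with (- (- Ci * z)) by ring.
  rewrite <- E; [ring|]. simpl. unfold Re in H. lra.
Qed.

Lemma slit_rotated (a : R) : (a <> 0)%R -> slit (- Ci * a) /\ slit (Ci * a).
Proof. intros H; split; apply slit_intro; simpl; lra. Qed.

(** * The Stokes matrices *)

(** The radius 1/s - s is the distance from an outer singular point to the nearest other one. *)
Lemma factors_near_outer_neq0 (eps a : R) (z : C) :
  (0 < eps < 1)%R -> Rabs a = (/ sqrt eps)%R ->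
  (0 < Cmod (z - a) < / sqrt eps - sqrt eps)%R ->
  forall j, sing_factor eps j z <> 0.
Proof.
  intros Heps Ha Hz.
  assert (Hs : (0 < sqrt eps)%R) by (apply sqrt_lt_R0; lra).
  set (s := sqrt eps) in *.
  assert (K : forall b : R, (b = a \/ / s - s <= Rabs (b - a))%R -> z - b <> 0).
  { intros b Hb E. apply Ceq_minus in E. subst z.
    rewrite <- RtoC_minus, Cmod_R in Hz.
    destruct Hb as [-> | Hb]; [|lra].
    rewrite Rminus_diag, Rabs_R0 in Hz. lra. }
  assert (Hi : (0 < / s)%R) by now apply Rinv_0_lt_compat.
  assert (A : a = (/ s)%R \/ a = (- / s)%R).
  { unfold Rabs in Ha. destruct (Rcase_abs a); lra. }
  intros j. destruct j; simpl; fold s.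
  4: { intros E. apply (K (/ s)%R).
       2: { replace (z - (/ s)%R) with (- ((/ s)%R - z)) by ring. rewrite E. ring. }
       destruct A as [-> | ->]; [now left|right].
       unfold Rabs; destruct Rcase_abs; lra. }
  all: apply K; unfold Rabs; destruct A as [-> | ->];
    try (now left); right; destruct Rcase_abs; lra.
Qed.

Lemma principal_quotient (eps : R) (b1 b2 g1 g2 : C) (h : C -> C) (z : C) :
  (forall (x : C) (l : logs), (forall j, Cexp (l j) = sing_factor eps j x) ->
     Phi2 eps b2 g2 l / Phi1 eps b1 g1 l = h x) ->
  (forall j, sing_factor eps j z <> 0) ->
  Phi2 eps b2 g2 (principal_logs eps z) / Phi1 eps b1 g1 (principal_logs eps z) = h z.
Proof.
  intros H Hz. apply H. intros j. now apply Cexp_Clog.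
Qed.

(** Equal prefactors cancel, so only the jump of the integral survives, in the upper right
    corner. *)
Lemma unipotent_connection (a b I1 I2 v : C) (A1 A2 : @matrix C 2 2) :
  a <> 0 -> b <> 0 -> I2 - I1 = v ->
  A1 = mat2 a (a * I1) 0 b -> A2 = mat2 a (a * I2) 0 b ->
  exists N, is_inverse A1 N /\ mat2 1 v 0 1 = Mmult N A2.
Proof.
  intros Ha Hb <- -> ->.
  exists (mat2 (/ a) (- I1 / b) 0 (/ b)).
  unfold is_inverse. rewrite Mone_mat2, !Mult_mat2.
  repeat split; f_equal; field; auto.
Qed.

(** The terms in G, 1 + z / q and 1 + p / z are common to both domains and cancel; what remains
    compares the rotated logarithms at x with those at q. *)
Lemma integral_jump (eps rho : R) (Up Low : C -> Prop) (p q : R) (k N : nat)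
    (c : C) (G fU fL : C -> C) (x IU IL : C) :
  (0 < eps < 1)%R -> (sqrt eps < rho < / sqrt eps)%R ->
  (p = sqrt eps \/ p = - sqrt eps)%R -> (q = / sqrt eps \/ q = - / sqrt eps)%R ->
  quotient_log_primitive p q k N c G ->
  sectorial_pair eps rho Up Low ->
  (forall z, Up z -> fU z = quotient p q k N z) ->
  (forall z, Low z -> fL z = quotient p q k N z) ->
  is_path_integral Up fU q x IU -> is_path_integral Low fL q x IL ->
  IL - IU = c * ((plog (- Ci * x) - plog (Ci * x)) -
                 (plog (- Ci * q) - plog (Ci * q))).
Proof.
  intros He Hr Hp Hq HG HD HU HL IntU IntL.
  assert (q0 : (q <> 0)%R).
  { assert (0 < / sqrt eps)%R by (apply Rinv_0_lt_compat, sqrt_lt_R0; lra).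
    destruct Hq; lra. }
  destruct (slit_rotated q q0) as [S1 S2].
  rewrite (domain_integral eps rho He Hr p q k N c G Hp Hq HG Up fU (- Ci) x IU); trivial.
  2: exact (up_cut _ _ _ _ HD).
  2: intros z Hz; exact (up_slit eps rho He Hr Up Low z HD Hz).
  rewrite (domain_integral eps rho He Hr p q k N c G Hp Hq HG Low fL Ci x IL); trivial.
  2: exact (low_cut _ _ _ _ HD).
  2: intros z Hz; exact (low_slit eps rho He Hr Up Low z HD Hz).
  unfold cut_primitive. ring.
Qed.

Theorem corollary5p4
    (eps rho : R) (b1 b2 g1 g2 xs : C)
    (O1 O2 : C -> Prop) (l1 l2 : C -> logs)
    (Psi1 Psi2 : C -> @matrix C 2 2)
    (Heps : (0 < eps < 1)%R)
    (Hrho : (sqrt eps < rho < / sqrt eps)%R)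
    (Hb : b1 <> b2)
    (Hres : double_resonance eps b1 b2 g1 g2)
    (Hdom : Stokes_domains eps rho g1 g2 O1 O2)
    (Hxs : is_base_point eps g1 g2 xs)
    (HPsi1 : is_Phi_inf_branch eps b1 b2 g1 g2 xs O1 l1 Psi1)
    (HPsi2 : is_Phi_inf_branch eps b1 b2 g1 g2 xs O2 l2 Psi2)
    (Hcoincide : forall x, adjacent g1 g2 O1 O2 x ->
       Phi1 eps b1 g1 (l1 x) = Phi1 eps b1 g1 (l2 x) /\
       Phi2 eps b2 g2 (l1 x) = Phi2 eps b2 g2 (l2 x)) :
  is_Stokes_matrix (Omega_LL O1 O2) Psi1 Psi2
    (Mexp (Mscal (2 * PI * Ci) (Tmat eps b1 b2 g1 g2 xLL))) /\
  is_Stokes_matrix (Omega_RR O1 O2) Psi1 Psi2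
    (Mexp (Mscal (2 * PI * Ci) (Tmat eps b1 b2 g1 g2 xRR))).
Proof.
  assert (Hs : (0 < sqrt eps)%R) by (apply sqrt_lt_R0; lra).
  assert (Hi : (0 < / sqrt eps)%R) by now apply Rinv_0_lt_compat.
  destruct (quotient_form eps rho Heps Hrho b1 b2 g1 g2 Hb Hres)
    as (p & k & N & Hp & Hquot).
  assert (Hq : exists q : R, (from_RR g1 g2 /\ q = / sqrt eps \/
                              ~ from_RR g1 g2 /\ q = - / sqrt eps)%R).
  { destruct (Rle_dec 0 (Re (g1 - g2))); eauto. }
  destruct Hq as [q Hq].
  assert (Hq' : (q = / sqrt eps \/ q = - / sqrt eps)%R) by tauto.
  specialize (Hquot q ltac:(tauto) ltac:(tauto)).
  assert (Exs : xs = q).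
  { destruct Hxs as [X1 X2], Hq as [[F ->]|[F ->]]; [now rewrite X1|now rewrite X2]. }
  subst xs.
  assert (Hpq : RtoC p <> RtoC q).
  { intros E; apply RtoC_inj in E. destruct Hp, Hq'; lra. }
  destruct (quotient_primitive p q k N Hpq) as (c & G & HG).
  assert (Rq : Rabs q = (/ sqrt eps)%R).
  { destruct Hq' as [-> | ->]; rewrite ?Rabs_Ropp, Rabs_pos_eq; lra. }
  (* This gives the identity matrix on the side of q, where the two integrals agree. *)
  assert (Res0 : residue (fun x => Phi2 eps b2 g2 (principal_logs eps x) /
                    Phi1 eps b1 g1 (principal_logs eps x)) q = 0).
  { apply (residue_at_base _ p q k N c G (/ sqrt eps - sqrt eps)%R HG).
    - rewrite <- RtoC_mult, Cmod_R, Rabs_mult, Rq, Rabs_pos_eq; lra.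
    - rewrite <- RtoC_plus, Cmod_R.
      destruct Hp as [-> | ->], Hq' as [-> | ->]; unfold Rabs; destruct Rcase_abs; lra.
    - intros z Hz. apply principal_quotient; trivial.
      now apply (factors_near_outer_neq0 eps q). }
  assert (Resc : residue (fun x => Phi2 eps b2 g2 (principal_logs eps x) /
                    Phi1 eps b1 g1 (principal_logs eps x)) (- q) = c).
  { apply (residue_at_pole _ p q k N c G (/ sqrt eps - sqrt eps)%R HG).
    - rewrite <- RtoC_minus, Cmod_R.
      destruct Hp as [-> | ->], Hq' as [-> | ->]; unfold Rabs; destruct Rcase_abs; lra.
    - intros z Hz. apply principal_quotient; trivial.
      apply (factors_near_outer_neq0 eps (- q)); trivial.
      + now rewrite Rabs_Ropp.
      + now rewrite RtoC_opp. }
  unfold Tmat, d_res. rewrite !Mscal_mat2, !Mexp_nilpotent.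
  destruct HPsi1 as [L1 HPsi1], HPsi2 as [L2 HPsi2].
  assert (F1 : forall z, O1 z ->
    Phi2 eps b2 g2 (l1 z) / Phi1 eps b1 g1 (l1 z) = quotient p q k N z).
  { intros z Hz. apply Hquot. intros j. now apply L1. }
  assert (F2 : forall z, O2 z ->
    Phi2 eps b2 g2 (l2 z) / Phi1 eps b1 g1 (l2 z) = quotient p q k N z).
  { intros z Hz. apply Hquot. intros j. now apply L2. }
  assert (Connection : forall x v : C, O1 x -> O2 x ->
    Phi1 eps b1 g1 (l1 x) = Phi1 eps b1 g1 (l2 x) /\
    Phi2 eps b2 g2 (l1 x) = Phi2 eps b2 g2 (l2 x) ->
    (forall I1 I2,
      is_path_integral O1
        (fun z => Phi2 eps b2 g2 (l1 z) / Phi1 eps b1 g1 (l1 z)) q x I1 ->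
      is_path_integral O2
        (fun z => Phi2 eps b2 g2 (l2 z) / Phi1 eps b1 g1 (l2 z)) q x I2 ->
      I2 - I1 = v) ->
    exists M, is_inverse (Psi1 x) M /\ mat2 1 v 0 1 = Mmult M (Psi2 x)).
  { intros x v H1 H2 [E1 E2] HI.
    destruct (HPsi1 x H1) as (I1 & P1 & Q1). destruct (HPsi2 x H2) as (I2 & P2 & Q2).
    rewrite <- E1, <- E2 in Q2.
    apply (unipotent_connection _ _ I1 I2 v _ _) with (3 := HI I1 I2 P1 P2) (4 := Q1) (5 := Q2).
    - rewrite Phi1_expand. apply Cexp_neq0.
    - rewrite Phi2_expand.
      repeat apply Cmult_neq_0; try apply Cinv_neq0; apply Cexp_neq0. }
  destruct Hdom as [Dom1 Dom2].
  destruct Hq as [[F Eq]|[F Eq]].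
  - specialize (Dom1 F). subst q.
    (* One sample point of the adjacent component is enough to transport the coincidence of the
       branches to both components. *)
    assert (Ht : exists t : R, (rho < t < / sqrt eps)%R)
      by (exists ((rho + / sqrt eps) / 2)%R; lra).
    destruct Ht as [t Ht]. apply (right_interval _ _ _ _ Dom1) in Ht.
    destruct (Hcoincide t (or_introl (conj F Ht))) as [C1 C2].
    destruct Ht as (T1 & T2 & _).
    assert (Co : forall x, O1 x -> O2 x -> _) by
      exact (fun x X1 X2 => Phi_coincide eps rho Heps Hrho O1 O2 l1 l2 b1 g1 b2 g2 x t
        (up_domain _ _ _ _ Dom1) (up_cut _ _ _ _ Dom1) L1
        (low_domain _ _ _ _ Dom1) (low_cut _ _ _ _ Dom1) L2 T1 T2 X1 X2 C1 C2).
    change (sing_point eps xRR) with (RtoC (/ sqrt eps)).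
    change (sing_point eps xLL) with (RtoC (- / sqrt eps)).
    rewrite RtoC_opp, Res0, Resc.
    (* At q the rotated logarithms differ by -pi i. At x they differ by pi i on the left and by -pi
       i on the right, so the jump is 2 pi i c and 0 respectively. *)
    split; intros x (X1 & X2 & X3); apply Connection; auto; intros I1 I2 P1 P2;
      rewrite (integral_jump eps rho O1 O2 p _ k N c G _ _ x I1 I2
                 Heps Hrho Hp Hq' HG Dom1 F1 F2 P1 P2),
        (plog_rotated_right (RtoC _)) by exact Hi.
    + rewrite plog_rotated_left by exact X3. ring.
    + rewrite plog_rotated_right by exact X3. ring.
  - specialize (Dom2 F). subst q.
    assert (Ht : exists t : R, (- / sqrt eps < t < - rho)%R)
      by (exists (- ((rho + / sqrt eps) / 2))%R; lra).
    destruct Ht as [t Ht]. apply (left_interval _ _ _ _ Dom2) in Ht.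
    destruct Ht as (T2 & T1 & T3).
    destruct (Hcoincide t (or_intror (conj F (conj T1 (conj T2 T3))))) as [C1 C2].
    assert (Co : forall x, O1 x -> O2 x -> _) by
      exact (fun x X1 X2 => Phi_coincide eps rho Heps Hrho O1 O2 l1 l2 b1 g1 b2 g2 x t
        (low_domain _ _ _ _ Dom2) (low_cut _ _ _ _ Dom2) L1
        (up_domain _ _ _ _ Dom2) (up_cut _ _ _ _ Dom2) L2 T1 T2 X1 X2 C1 C2).
    change (sing_point eps xRR) with (RtoC (/ sqrt eps)).
    change (sing_point eps xLL) with (RtoC (- / sqrt eps)).
    rewrite <- RtoC_opp, Ropp_involutive in Resc.
    rewrite Res0, Resc.
    assert (Hneg : (Re (RtoC (- / sqrt eps)) < 0)%R) by (simpl; lra).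
    (* Here [O2] is the upper domain and q is on the left: the order of subtraction and the
       difference at q both change sign, and the jump 2 pi i c appears on the right. *)
    split; intros x (X1 & X2 & X3); apply Connection; auto; intros I1 I2 P1 P2;
      replace (I2 - I1) with (- (I1 - I2)) by ring;
      rewrite (integral_jump eps rho O2 O1 p _ k N c G _ _ x I2 I1
                 Heps Hrho Hp Hq' HG Dom2 F2 F1 P2 P1),
        (plog_rotated_left (RtoC _)) by exact Hneg.
    + rewrite plog_rotated_left by exact X3. ring.
    + rewrite plog_rotated_right by exact X3. ring.
Qed.
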